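(* (i) Let $k\in\{3,4\}$, let $A=A_{2,k}$ and let $f$ be any bijection fixing the identity from $A$ to an isomorphic copy of $A$. Then $G(A;f)$ is a $2$-group of order at most $2^{2^{k}+k-1}$, has nilpotency class at most $5$ and derived length at most $3$. (ii) Let $A=A_{3,3}$ and let $f$ be any bijection fixing the identity from $A$ to an isomorphic copy of $A$. Then $G(A;f)$ is a $3$-group of order at most $3^{9}$ and has nilpotency class at most $2$.
   Context: $A_{p,k}$ denotes the elementary abelian $p$-group of rank $k$ ($p$ prime). For groups $H,K$ and a bijection $f:H\to K$ with $e^{f}=e$, $G(H,K;f)=\langle H,K\mid hh^{f}=h^{f}h\text{ for all }h\in H\rangle$, i.e. the quotient of the free product $H*K$ by the normal closure of all commutators $[h,h^{f}]$, $h\in H$. When $H$ is isomorphic to $K$ one writes $G(H;f)$ for $G(H,K;f)$. *)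

(* Defs.v *)
From HB Require Import structures.
From mathcomp Require Import all_boot all_fingroup all_solvable.
From mathcomp Require Import boolp.

Set Implicit Arguments.
Unset Strict Implicit.
Unset Printing Implicit Defensive.

Import GroupScope.
Local Open Scope group_scope.
Local Open Scope quotient_scope.

(* fingroup shadows the canonical representative of a quotient class. *)
Local Notation repr := generic_quotient.repr.

(* Free product of two arbitrary (possibly infinite) groups: words over the
   disjoint union of the carriers, modulo the least congruence that multiplies
   adjacent letters of the same factor and deletes the identity letters. *)
Section FreeProduct.
Variables H K : groupType.

Inductive fp_cong : seq (H + K) -> seq (H + K) -> Prop :=
| fp_refl u : fp_cong u u
| fp_sym u v of fp_cong u v : fp_cong v u
| fp_trans u v w of fp_cong u v & fp_cong v w : fp_cong u w
| fp_cat u u' v v' of fp_cong u u' & fp_cong v v' :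
    fp_cong (u ++ v) (u' ++ v')
| fp_onel : fp_cong [:: inl 1] [::]
| fp_oner : fp_cong [:: inr 1] [::]
| fp_mull (x y : H) : fp_cong [:: inl x; inl y] [:: inl (x * y)]
| fp_mulr (x y : K) : fp_cong [:: inr x; inr y] [:: inr (x * y)].

Definition fp_congb : rel (seq (H + K)) := fun u v => `[< fp_cong u v >].

Lemma fp_congb_equiv : equiv_class_of fp_congb.
Proof.
split=> [u|u v|v u w].
- exact/asboolP/fp_refl.
- by apply/asboolP/asboolP; apply: fp_sym.
- by move=> /asboolP uv /asboolP vw; apply/asboolP/(fp_trans uv vw).
Qed.

Canonical fp_congb_rel := EquivRelPack fp_congb_equiv.

Definition freeprod := {eq_quot fp_congb}.
HB.instance Definition _ : EqQuotient _ fp_congb freeprod :=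
  EqQuotient.on freeprod.
HB.instance Definition _ := Choice.on freeprod.

Definition fp_word (u : seq (H + K)) : freeprod := \pi u.

Lemma fp_wordP u v : fp_word u = fp_word v <-> fp_cong u v.
Proof. by split=> [/eqmodP/asboolP|uv]; last apply/eqmodP/asboolP. Qed.

Lemma fp_word_surj x : exists u, x = fp_word u.
Proof. by exists (repr x); rewrite /fp_word reprK. Qed.

Lemma fp_reprP u : fp_cong (repr (fp_word u)) u.
Proof. by apply/fp_wordP; rewrite /fp_word reprK. Qed.

Definition invl (s : H + K) : H + K :=
  match s with inl x => inl x^-1 | inr y => inr y^-1 end.
Definition invw (u : seq (H + K)) := rev (map invl u).

Lemma invw_cat u v : invw (u ++ v) = invw v ++ invw u.
Proof. by rewrite /invw map_cat rev_cat. Qed.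

Lemma invw_cong u v : fp_cong u v -> fp_cong (invw u) (invw v).
Proof.
elim=> {u v} [u|u v _|u v w _ uv _ vw|u u' v v' _ IHu _ IHv|||x y|x y].
- exact: fp_refl.
- exact: fp_sym.
- exact: fp_trans uv vw.
- by rewrite !invw_cat; apply: fp_cat.
- by rewrite /invw /= invg1; apply: fp_onel.
- by rewrite /invw /= invg1; apply: fp_oner.
- by rewrite /invw /= invMg; apply: fp_mull.
- by rewrite /invw /= invMg; apply: fp_mulr.
Qed.

Definition fp_one : freeprod := fp_word [::].
Definition fp_mul (x y : freeprod) : freeprod := fp_word (repr x ++ repr y).
Definition fp_inv (x : freeprod) : freeprod := fp_word (invw (repr x)).

Lemma fp_mulE u v : fp_mul (fp_word u) (fp_word v) = fp_word (u ++ v).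
Proof. by apply/fp_wordP; apply: fp_cat; apply: fp_reprP. Qed.

Lemma fp_invE u : fp_inv (fp_word u) = fp_word (invw u).
Proof. by apply/fp_wordP/invw_cong/fp_reprP. Qed.

Lemma fp_mulA : associative fp_mul.
Proof.
move=> x y z; have [u ->] := fp_word_surj x; have [v ->] := fp_word_surj y.
by have [w ->] := fp_word_surj z; rewrite !fp_mulE catA.
Qed.

Lemma fp_mul1 : left_id fp_one fp_mul.
Proof. by move=> x; have [u ->] := fp_word_surj x; rewrite fp_mulE. Qed.

Lemma fp_mulr1 : right_id fp_one fp_mul.
Proof. by move=> x; have [u ->] := fp_word_surj x; rewrite fp_mulE cats0. Qed.

Lemma invlK : involutive invl.
Proof. by case=> x /=; rewrite invgK. Qed.

Lemma invwK : involutive invw.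
Proof. by move=> u; rewrite /invw map_rev revK mapK //; apply: invlK. Qed.

Lemma invwV u : fp_cong (invw u ++ u) [::].
Proof.
elim: u => [|s u IHu]; first exact: fp_refl.
rewrite -cat1s invw_cat -catA [X in _ ++ X]catA.
apply: fp_trans IHu; apply: fp_cat; first exact: fp_refl.
rewrite -[X in fp_cong _ X]cat0s; apply: fp_cat; last exact: fp_refl.
case: s => x; rewrite /invw /=.
- by apply: fp_trans (fp_mull _ _) _; rewrite mulVg; apply: fp_onel.
- by apply: fp_trans (fp_mulr _ _) _; rewrite mulVg; apply: fp_oner.
Qed.

Lemma fp_mulV : left_inverse fp_one fp_inv fp_mul.
Proof.
move=> x; have [u ->] := fp_word_surj x; rewrite fp_invE fp_mulE.
exact/fp_wordP/invwV.
Qed.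

Lemma fp_mulrV : right_inverse fp_one fp_inv fp_mul.
Proof.
move=> x; have [u ->] := fp_word_surj x; rewrite fp_invE fp_mulE.
by apply/fp_wordP; rewrite -{1}[u]invwK; apply: invwV.
Qed.

HB.instance Definition _ :=
  isGroup.Build freeprod fp_mulA fp_mul1 fp_mulr1 fp_mulV fp_mulrV.

Definition fp_inl (x : H) : freeprod := fp_word [:: inl x].
Definition fp_inr (y : K) : freeprod := fp_word [:: inr y].

Lemma fp_inlM : {morph fp_inl : x y / x * y}.
Proof.
by move=> x y; rewrite [RHS]fp_mulE; apply/fp_wordP/fp_sym/fp_mull.
Qed.

Lemma fp_inrM : {morph fp_inr : x y / x * y}.
Proof.
by move=> x y; rewrite [RHS]fp_mulE; apply/fp_wordP/fp_sym/fp_mulr.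
Qed.

End FreeProduct.

(* Quotient of a group by the normal closure of a set of elements. *)
Section NormalClosureQuotient.
Variables (G : groupType) (S : G -> Prop).

Inductive normal_closure : G -> Prop :=
| ncl_mem x of S x : normal_closure x
| ncl_one : normal_closure 1
| ncl_mul x y of normal_closure x & normal_closure y : normal_closure (x * y)
| ncl_inv x of normal_closure x : normal_closure x^-1
| ncl_conj x z of normal_closure x : normal_closure (x ^ z).

Definition ncl_eqb : rel G := fun x y => `[< normal_closure (x^-1 * y) >].

Lemma ncl_eqb_equiv : equiv_class_of ncl_eqb.
Proof.
have sym x y : ncl_eqb x y -> ncl_eqb y x.
  by move=> /asboolP/ncl_inv xy; apply/asboolP; rewrite invMg invgK in xy.
split=> [x|x y|y x z].
- by apply/asboolP; rewrite mulVg; apply: ncl_one.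
- by apply/idP/idP; apply: sym.
- move=> /asboolP xy /asboolP yz; apply/asboolP.
  by have := ncl_mul xy yz; rewrite -mulgA mulKVg.
Qed.

Canonical ncl_eqb_rel := EquivRelPack ncl_eqb_equiv.

Definition ncl_quot := {eq_quot ncl_eqb}.
HB.instance Definition _ : EqQuotient G ncl_eqb ncl_quot :=
  EqQuotient.on ncl_quot.
HB.instance Definition _ := Choice.on ncl_quot.

Definition ncl_pi (x : G) : ncl_quot := \pi x.

Lemma ncl_piP x y : ncl_pi x = ncl_pi y <-> normal_closure (x^-1 * y).
Proof. by split=> [/eqmodP/asboolP|xy]; last apply/eqmodP/asboolP. Qed.

Lemma ncl_pi_surj a : exists x, a = ncl_pi x.
Proof. by exists (repr a); rewrite /ncl_pi reprK. Qed.

Lemma ncl_reprP x : normal_closure ((repr (ncl_pi x))^-1 * x).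
Proof. by apply/ncl_piP; rewrite /ncl_pi reprK. Qed.

Definition ncl_q1 : ncl_quot := ncl_pi 1.
Definition ncl_qmul (a b : ncl_quot) : ncl_quot := ncl_pi (repr a * repr b).
Definition ncl_qinv (a : ncl_quot) : ncl_quot := ncl_pi (repr a)^-1.

Lemma ncl_qmulE x y : ncl_qmul (ncl_pi x) (ncl_pi y) = ncl_pi (x * y).
Proof.
apply/ncl_piP.
have := ncl_mul (ncl_reprP y) (ncl_conj y (ncl_reprP x)).
by rewrite conjgE invMg !mulgA mulgK.
Qed.

Lemma ncl_qinvE x : ncl_qinv (ncl_pi x) = ncl_pi x^-1.
Proof.
apply/ncl_piP; rewrite invgK.
have := ncl_conj x^-1 (ncl_inv (ncl_reprP x)).
by rewrite conjgE invMg !invgK !mulgA mulgV mul1g.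
Qed.

Lemma ncl_qmulA : associative ncl_qmul.
Proof.
move=> a b c; have [x ->] := ncl_pi_surj a; have [y ->] := ncl_pi_surj b.
by have [z ->] := ncl_pi_surj c; rewrite !ncl_qmulE mulgA.
Qed.

Lemma ncl_qmul1 : left_id ncl_q1 ncl_qmul.
Proof. by move=> a; have [x ->] := ncl_pi_surj a; rewrite ncl_qmulE mul1g. Qed.

Lemma ncl_qmulr1 : right_id ncl_q1 ncl_qmul.
Proof. by move=> a; have [x ->] := ncl_pi_surj a; rewrite ncl_qmulE mulg1. Qed.

Lemma ncl_qmulV : left_inverse ncl_q1 ncl_qinv ncl_qmul.
Proof.
by move=> a; have [x ->] := ncl_pi_surj a; rewrite ncl_qinvE ncl_qmulE mulVg.
Qed.

Lemma ncl_qmulrV : right_inverse ncl_q1 ncl_qinv ncl_qmul.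
Proof.
by move=> a; have [x ->] := ncl_pi_surj a; rewrite ncl_qinvE ncl_qmulE mulgV.
Qed.

HB.instance Definition _ :=
  isGroup.Build ncl_quot ncl_qmulA ncl_qmul1 ncl_qmulr1 ncl_qmulV ncl_qmulrV.

Lemma ncl_piM : {morph ncl_pi : x y / x * y}.
Proof. by move=> x y; rewrite [RHS]ncl_qmulE. Qed.

End NormalClosureQuotient.

(* G(H, K; f) = < H, K | h h^f = h^f h for all h in H > *)
Section WeakCommutativity.
Variables (H K : groupType) (f : H -> K).

Definition wcomm_rel (z : freeprod H K) : Prop :=
  exists h : H, z = [~ fp_inl K h, fp_inr H (f h)].

Definition wcomm : groupType := ncl_quot wcomm_rel.

Definition wcomm_inl (x : H) : wcomm := ncl_pi wcomm_rel (fp_inl K x).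
Definition wcomm_inr (y : K) : wcomm := ncl_pi wcomm_rel (fp_inr H y).

Lemma wcomm_inlM : {morph wcomm_inl : x y / x * y}.
Proof. by move=> x y; rewrite /wcomm_inl fp_inlM ncl_piM. Qed.

Lemma wcomm_inrM : {morph wcomm_inr : x y / x * y}.
Proof. by move=> x y; rewrite /wcomm_inr fp_inrM ncl_piM. Qed.

Lemma wcomm_commute h : commute (wcomm_inl h) (wcomm_inr (f h)).
Proof.
rewrite /commute /wcomm_inl /wcomm_inr -!ncl_piM; apply/esym/ncl_piP.
have := @ncl_mem _ wcomm_rel _ (ex_intro _ h erefl).
by rewrite /commg /conjg invMg !mulgA.
Qed.

Section UniversalProperty.
Variables (M : groupType) (a : {multiplicative H -> M}).
Variables (b : {multiplicative K -> M}).
Hypothesis abC : forall h, commute (a h) (b (f h)).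

Let gM1 (L : groupType) (c : {multiplicative L -> M}) : c 1 = 1.
Proof. by apply: (mulgI (c 1)); rewrite -gmulfM !mulg1. Qed.

Definition ev_letter (s : H + K) : M :=
  match s with inl x => a x | inr y => b y end.
Fixpoint ev_word (u : seq (H + K)) : M :=
  if u is s :: v then ev_letter s * ev_word v else 1.

Let ev_cat u v : ev_word (u ++ v) = ev_word u * ev_word v.
Proof. by elim: u => [|s u /= ->]; rewrite ?mul1g ?mulgA. Qed.

Let ev_cong u v : fp_cong u v -> ev_word u = ev_word v.
Proof.
elim=> {u v} //= [u v w _ -> _ ->|u u' v v' _ IHu _ IHv|||x y|x y] //.
- by rewrite !ev_cat IHu IHv.
- by rewrite gM1 mulg1.
- by rewrite gM1 mulg1.
- by rewrite gmulfM !mulg1.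
- by rewrite gmulfM !mulg1.
Qed.

Let lift0 (x : freeprod H K) : M := ev_word (repr x).

Let lift0E u : lift0 (fp_word u) = ev_word u.
Proof. exact/ev_cong/fp_reprP. Qed.

Let lift0M : {morph lift0 : x y / x * y}.
Proof. by move=> x y; rewrite lift0E ev_cat. Qed.

HB.instance Definition _ := isMultiplicative.Build _ _ lift0 lift0M.

Let lift0V x : lift0 x^-1 = (lift0 x)^-1.
Proof. by apply: (mulgI (lift0 x)); rewrite -lift0M !mulgV (gM1 lift0). Qed.

Let lift0_ncl x : normal_closure wcomm_rel x -> lift0 x = 1.
Proof.
elim=> {x} [_ [h ->]||x y _ Ex _ Ey|x _ Ex|x z _ Ex].
- have El x : lift0 (fp_inl K x) = a x by rewrite lift0E /= mulg1.
  have Er y : lift0 (fp_inr H y) = b y by rewrite lift0E /= mulg1.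
  rewrite /commg /conjg !lift0M !lift0V El Er.
  by rewrite (abC h) !mulgA mulgKV mulVg.
- exact: (gM1 lift0).
- by rewrite lift0M Ex Ey mulg1.
- by rewrite lift0V Ex invg1.
- by rewrite /conjg !lift0M lift0V Ex mul1g mulVg.
Qed.

Lemma wcomm_lift : exists g : {multiplicative wcomm -> M},
  (forall x, g (wcomm_inl x) = a x) /\ (forall y, g (wcomm_inr y) = b y).
Proof.
pose g (x : wcomm) := lift0 (repr x).
have gE x : g (ncl_pi wcomm_rel x) = lift0 x.
  have := lift0_ncl (ncl_reprP wcomm_rel x); rewrite lift0M lift0V => E.
  by apply: (mulgI (lift0 (repr (ncl_pi wcomm_rel x)))^-1); rewrite mulVg E.
have gM : {morph g : x y / x * y}.
  move=> x y; have [x' ->] := ncl_pi_surj x; have [y' ->] := ncl_pi_surj y.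
  by rewrite -ncl_piM !gE lift0M.
pose gMx := isMultiplicative.Build _ _ g gM.
pose g' : {multiplicative wcomm -> M} := HB.pack g gMx.
by exists g'; split=> x; rewrite [LHS]gE lift0E /= mulg1.
Qed.

Lemma wcomm_ext (g g' : {multiplicative wcomm -> M}) :
  (forall x, g (wcomm_inl x) = g' (wcomm_inl x)) ->
  (forall y, g (wcomm_inr y) = g' (wcomm_inr y)) -> g =1 g'.
Proof.
move=> El Er x; have [z ->] := ncl_pi_surj x; have [u ->] := fp_word_surj z.
elim: u => [|s u IHu]; first by rewrite (gM1 g) (gM1 g').
have ->: fp_word (s :: u) = fp_word [:: s] * fp_word u by rewrite [RHS]fp_mulE.
by rewrite ncl_piM !gmulfM IHu; case: s => t; congr (_ * _); rewrite ?El ?Er.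
Qed.

End UniversalProperty.
End WeakCommutativity.

Definition isomorphic (G Q : groupType) : Prop :=
  exists phi : {multiplicative G -> Q}, bijective phi.

(* Main.v *)
(* Write h^k for the conjugate of h in A by k in B, and g for the inverse of f.

   Since h^(k f(h)) = h^k, the element g(k f(h)) of A always commutes with h^k,
   which makes the subgroups C_A(h^k) large.  For |A| = 16 the relation
   "[h^(y^k), z] = 1" is therefore total or nondegenerate modulo its
   radical; in the second case the nontrivial values reduce to a single involution
   D, which turns out to be central in the group.  Modulo the centre the normal
   closures of A and of B then have class at most 2, so that their product has
   class at most 4 and a central second derived subgroup; rank 3 is reduced to
   rank 4 by adding a direct factor of order 2.  For |A| = 27 the relation
   "[h^k, y] = 1" already is total or nondegenerate; a nondegenerate relation
   would give a trilinear map A x B x A -> F_3, symmetric in A, and an involution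
   on the 13 points of P(A) whose fixed point contradicts nondegeneracy.  So both
   normal closures are abelian.

   Finiteness (Sidki): an element with an alternating expression of length m + 1
   and no shorter one has at least m possible last letters, none of them trivial;
   counting these bounds the order by n 2^(n - 1) where n = |A|. *)

Require Import Defs.
From HB Require Import structures.
From mathcomp Require Import all_boot all_fingroup all_solvable.
From mathcomp Require Import zmodp zify.

Set Implicit Arguments.
Unset Strict Implicit.
Unset Printing Implicit Defensive.

Import GroupScope.
Local Open Scope group_scope.

(** * Commutation between A and its conjugates *)

(** The bijection [f] respects nothing but the identity, so linear algebra becomes available only
    once enough commutators are known to be central; until then the argument counts. The permutation
    [h |-> g (k * f h)] sends every [h] into the subgroup of elements commuting with [h^k], and a
    subgroup of a group of order 16 that receives more than 8 values of an injective map is the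
    whole group. Usually 12 values are at hand, indexed by the complement of a subgroup of order 4.

    The statements concern homomorphisms [a], [b] into a finite group, not embeddings. They
    therefore apply to the quotient by the centre, and the extra factor of order 2 for rank 3 may
    simply be sent to 1.

    The hard point for order 16 is that [B] centralizes [D]. The commutators [h, y^k, z] define a
    trilinear form over F_2. If it is not alternating, comparing two expressions for one commutator
    gives [D ^ b k = D] directly. If it is alternating, expanding commutators of products in two
    ways leaves correction terms, one equal to [D] and one to a conjugate under [b k], and these
    have to cancel. *)

Section Commute.
Variable gT : finGroupType.
Implicit Types x y z u w : gT.

Lemma commuteJ x y z : commute x y -> commute (x ^ z) (y ^ z).
Proof. by move=> cxy; rewrite /commute -!conjMg cxy. Qed.

Lemma commuteJl x y z : commute (x ^ z) y <-> commute x (y ^ z^-1).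
Proof.
by split=> /commuteJ c; [have := c z^-1 | have := c z]; rewrite ?conjgK ?conjgKV.
Qed.

Lemma commute_comm x y z : commute x y -> commute x z -> commute x [~ y, z].
Proof. by move=> cxy cxz; rewrite commgEl conjgE;
  do !apply: commuteM || apply: commuteV. Qed.

Lemma conjg_commute x y : commute x y -> x ^ y = x.
Proof. by move=> cxy; rewrite conjgE cxy mulKg. Qed.

Lemma commute_conjg x y : x ^ y = x -> commute x y.
Proof. by move=> xy; apply/esym; rewrite /commute -{1}xy conjgE mulKVg. Qed.

Lemma commute_conj2 w x y : commute w x -> commute w y -> commute w (x ^ y).
Proof. by move=> cwx cwy; rewrite conjgE; do !apply: commuteM || apply: commuteV. Qed.

Lemma mulgg1_inv x : x * x = 1 -> x^-1 = x.
Proof. by move=> xx; apply/eqP; rewrite eq_invg_mul xx. Qed.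

End Commute.

Section Perp.
Variables (gT A : finGroupType) (a : {morphism [set: A] >-> gT}).
Hypothesis cAA : abelian [set: A].
Implicit Types (u : gT) (h y z : A).

Lemma commute_abelian (x y : A) : commute x y.
Proof. by apply: (centsP cAA); rewrite inE. Qed.

Lemma morphTM x y : a (x * y) = a x * a y. Proof. by rewrite morphM ?inE. Qed.
Lemma morphTV x : a x^-1 = (a x)^-1. Proof. by rewrite morphV ?inE. Qed.
Lemma commute_morph x y : commute (a x) (a y).
Proof. by rewrite /commute -!morphTM commute_abelian. Qed.

Lemma mem_precent1 w x : reflect (commute w (a x)) (x \in a @*^-1 'C[w]).
Proof.
have ->: (x \in a @*^-1 'C[w]) = (a x \in 'C[w]) by rewrite !inE.
by apply: (iffP cent1P) => /commute_sym.
Qed.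

Definition perp u h := a @*^-1 'C[a h ^ u].
Canonical perp_group u h := [group of perp u h].

Lemma perpP u h y : reflect (commute (a h ^ u) (a y)) (y \in perp u h).
Proof. exact: mem_precent1. Qed.

Lemma perp_sym u h y : (y \in perp u h) = (h \in perp u^-1 y).
Proof. by apply/perpP/perpP=> [/commuteJl|/commuteJl] /commute_sym; rewrite ?invgK. Qed.

Lemma perpN u h y : (y \notin perp u h) = ([~ a h ^ u, a y] != 1).
Proof. by congr (~~ _); apply/perpP/commgP. Qed.

End Perp.

Lemma prime_index_sub (gT : finGroupType) (p : nat) (S1 S S2 : {group gT}) x :
    prime p -> #|S2| = (p * #|S1|)%N -> S1 \subset S -> S \subset S2 ->
  x \in S -> x \notin S1 -> S = S2 :> {set gT}.
Proof.
move=> pr_p oS2 sS1 sS2 Sx S1x; apply/eqP; rewrite eqEcard sS2 oS2 /=.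
have iS1 : #|S : S1| != 1%N.
  by rewrite indexg_eq1; apply: contra S1x => /subsetP->.
rewrite -(Lagrange sS1) -(elimT (prime_nt_dvdP pr_p iS1)) 1?mulnC //.
rewrite -(@dvdn_pmul2r #|S1|) ?cardG_gt0 // -oS2 mulnC Lagrange //.
exact: cardSg.
Qed.

Lemma notin_two_subgroups (gT : finGroupType) (S T : {group gT}) x y :
  x \notin S -> y \notin T -> exists z, z \notin S /\ z \notin T.
Proof.
move=> Sx Ty; have [Tx|Tx] := boolP (x \in T); last by exists x.
have [Sy|Sy] := boolP (y \in S); last by exists y.
by exists (x * y); rewrite groupMr // groupMl.
Qed.

(** * Nondegenerate commutation relations between [A ^ u] and [A] *)

Section Nondegenerate.
Variables (gT A : finGroupType) (a : {morphism [set: A] >-> gT}).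
Hypothesis cAA : abelian [set: A].
Local Notation perp := (perp a).
Implicit Types (u : gT) (h y z : A).

Definition rad u := \bigcap_h perp u h.
Canonical rad_group u := [group of rad u].

Lemma radP u y : reflect (forall h, y \in perp u h) (y \in rad u).
Proof. by apply: (iffP bigcapP) => [ry h|ry h _]; rewrite ry. Qed.

(** By [perp_sym], [rad u^-1] is the left radical of the relation whose right radical is [rad u];
    inverting [u] is the duality used throughout. *)
Lemma radVP u h : reflect (forall y, y \in perp u h) (h \in rad u^-1).
Proof.
by apply: (iffP (radP _ _)) => rh y; have := rh y; rewrite perp_sym ?invgK.
Qed.

Lemma rad_sub u h : rad u \subset perp u h.
Proof. by apply/subsetP=> y /radP. Qed.

Lemma comm_commg u h z : [~ [~ a h, u], a z] = [~ a h ^ u, a z].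
Proof.
have -> : [~ a h, u] = (a h)^-1 * a h ^ u by [].
have /commgP/eqP c : commute (a h)^-1 (a z) by rewrite -(morphTV a); apply: commute_morph.
by rewrite commMgJ c conj1g mul1g.
Qed.

Lemma comm_mull u h v y : v \in perp u^-1 y ->
  [~ a (h * v) ^ u, a y] = [~ a h ^ u, a y].
Proof.
rewrite -perp_sym => /perpP cvy; rewrite morphTM conjMg commMgJ.
rewrite (eqP (introT commgP cvy)) mulg1 conjRg.
by rewrite (conjg_commute (commute_sym cvy)) -conjJg (conjg_commute (commute_morph _
  cAA _ _)).
Qed.

Lemma comm_mulr u h v y : v \in perp u h ->
  [~ a h ^ u, a (y * v)] = [~ a h ^ u, a y].
Proof.
move=> /perpP chv; rewrite morphTM commgMJ (eqP (introT commgP chv)) mul1g conjRg.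
by rewrite (conjg_commute chv) (conjg_commute (commute_morph _ cAA _ _)).
Qed.

(* The commutation relation between A^u and A is nondegenerate modulo its
   radicals, and these have index p ^ 2. *)
Definition nondeg p u := [/\ #|[set: A]| = (p * p * #|rad u|)%N,
    #|rad u^-1| = #|rad u|,
    forall h, h \notin rad u^-1 -> #|perp u h| = (p * #|rad u|)%N
  & forall y, y \notin rad u -> #|perp u^-1 y| = (p * #|rad u|)%N].

Lemma nondegV p u : nondeg p u -> nondeg p u^-1.
Proof. by case=> oA oR ph py; split; rewrite ?invgK ?oR. Qed.

Section Prime.
Variable p : nat.
Hypothesis pr_p : prime p.

(** The centralizer of [e] in [A] contains [perp u h], of index [p]. As [e] does not change when [h]
    becomes [h * v] with [v] perpendicular to [y], it also contains [perp u (h * v)]; a suitable [v]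
    takes it beyond [perp u h]. *)
Lemma nondeg_comm_cent u h y z : nondeg p u ->
  commute [~ a h ^ u, a y] (a z).
Proof.
move=> [oA oR ph py]; set e := [~ _, _].
have [/perpP/commgP/eqP hy|nhy] := boolP (y \in perp u h).
  by rewrite /e hy; apply/commute_sym/commute1.
have Lh : h \notin rad u^-1 by apply: contra nhy => /radVP.
have Ry : y \notin rad u by apply: contra nhy => /radP.
pose P := [group of perp u^-1 y].
have Ph : h \notin P by rewrite -perp_sym.
have LP : #|P| = (p * #|rad u^-1|)%N by rewrite py ?oR.
have sRP : rad u^-1 \subset P by apply: rad_sub.
have [v Pv Lv] : exists2 v, v \in P & v \notin rad u^-1.
  apply/subsetPn; apply/negP=> /subset_leq_card; rewrite LP.
  by rewrite leqNgt ltn_Pmull ?prime_gt1 // cardG_gt0.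
have Lhv : h * v \notin rad u^-1.
  by apply: contra nhy => /radVP/(_ y); rewrite perp_sym groupMr // -perp_sym.
have cS w x : x \in perp u w -> [~ a w ^ u, a y] = e -> commute e (a x).
  move=> /perpP cwx <-; apply/commute_sym/commute_comm; last exact: commute_morph.
  exact: commute_sym.
pose S := (a @*^-1 'C[e])%G.
have inS x : commute e (a x) -> x \in S.
  by move=> cex; apply/mem_precent1.
have sS1 : perp u h \subset S by apply/subsetP=> x /cS cx; apply/inS/cx.
have sS2 : perp u (h * v) \subset S.
  by apply/subsetP=> x /cS cx; apply/inS/cx; rewrite comm_mull.
suff [x Sx hx] : exists2 x, x \in S & x \notin perp u h.
  have cT : S = [set: A] :> {set A} -> commute e (a z).
    by move=> ST; have: z \in (S : {set A}); [rewrite ST inE | move/mem_precent1].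
  apply: cT; apply: (@prime_index_sub _ p [group of perp u h] S [set: A]%G x) => //.
    by rewrite ph // oA mulnA.
  exact: subsetT.
(* Otherwise some [s] outside [rad u] is perpendicular to [h * v] and to [h], hence to [v]. Then
   [perp u^-1 s] contains [P], which [v] generates over the radical, and also [h] outside [P]; so it
   is everything and [s] lies in the radical. *)
apply/subsetPn; apply/negP=> sSh.
have [s hvs Rs] : exists2 s, s \in perp u (h * v) & s \notin rad u.
  apply/subsetPn; apply/negP=> /subset_leq_card; rewrite ph //.
  by rewrite leqNgt ltn_Pmull ?prime_gt1 // cardG_gt0.
have hs := subsetP sSh _ (subsetP sS2 _ hvs).
move: (hvs) (hs); rewrite ![s \in _]perp_sym => Qhv Qh.
pose Q := [group of perp u^-1 s].
have Qv : v \in Q by rewrite -(groupMl v (_ : h \in Q)).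
have sPQ : P \subset Q.
  have PQ : (P :&: Q)%G = P :> {set A}.
    apply: (@prime_index_sub _ p (rad_group u^-1) _ _ v) => //=.
    - by rewrite subsetI !rad_sub.
    - exact: subsetIl.
    - by rewrite inE Pv.
  by apply/setIidPl.
have QT : Q = [set: A] :> {set A}.
  apply: (@prime_index_sub _ p P Q [set: A]%G h) => //; last exact: subsetT.
  by rewrite py // oA mulnA.
by case/negP: Rs; apply/radP=> w; rewrite perp_sym;
  have: w \in (Q : {set A}) by rewrite QT inE.
Qed.

(** Conjugation by [u^-1] turns the commutator into the inverse of one belonging to [u^-1], and
    [nondeg] is self-dual. *)
Lemma nondeg_comm_centJ u h y z : nondeg p u ->
  commute [~ a h ^ u, a y] (a z ^ u).
Proof.
move=> ndu; rewrite -[X in commute X _](conjgKV u); apply: commuteJ.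
rewrite conjRg conjgK -invgR; apply/commute_sym/commuteV/commute_sym.
exact: nondeg_comm_cent (nondegV ndu).
Qed.

(** By [nondeg_comm_cent] the commutator is multiplicative in [y], so the elements with value in a
    fixed subgroup form a subgroup; here it contains [perp u h], of prime index, and [y1]. *)
Lemma nondeg_cycler u h y1 y2 : nondeg p u -> y1 \notin perp u h ->
  [~ a h ^ u, a y2] \in <[ [~ a h ^ u, a y1] ]>.
Proof.
move=> ndu nhy; have [oA _ ph _] := ndu; set E := <[_]>.
pose S := [set y | [~ a h ^ u, a y] \in E].
have gS : group_set S.
  apply/group_setP; split=> [|x y]; first by rewrite inE morph1 commg1 group1.
  rewrite !inE => Ex Ey;
    rewrite morphTM commgMJ (conjg_commute (nondeg_comm_cent _ _ _ ndu)).
  exact: groupM.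
suff ST : Group gS = [set: A] :> {set A}.
  by have : y2 \in S; [rewrite [S]ST inE | rewrite inE].
have Lh : h \notin rad u^-1 by apply: contra nhy => /radVP.
apply: (@prime_index_sub _ p [group of perp u h] _ [set: A]%G y1) => //.
- by rewrite ph // oA mulnA.
- by apply/subsetP=> x /perpP/commgP/eqP hx; rewrite inE hx group1.
- exact: subsetT.
- by rewrite inE cycle_id.
Qed.

Lemma nondeg_cyclel u h1 h2 y : nondeg p u -> y \notin perp u h1 ->
  [~ a h2 ^ u, a y] \in <[ [~ a h1 ^ u, a y] ]>.
Proof.
move=> ndu nhy; have [oA _ _ py] := ndu; set E := <[_]>.
pose S := [set h | [~ a h ^ u, a y] \in E].
have gS : group_set S.
  apply/group_setP; split=> [|x z]; first by rewrite inE morph1 conj1g comm1g group1.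
  rewrite !inE => Ex Ey; rewrite morphTM conjMg commMgJ.
  by rewrite (conjg_commute (nondeg_comm_centJ _ _ _ ndu)) groupM.
suff ST : Group gS = [set: A] :> {set A}.
  by have : h2 \in S; [rewrite [S]ST inE | rewrite inE].
have Ry : y \notin rad u by apply: contra nhy => /radP.
apply: (@prime_index_sub _ p [group of perp u^-1 y] _ [set: A]%G h1) => //.
- by rewrite py // oA mulnA.
- apply/subsetP=> x; rewrite -perp_sym => /perpP/commgP/eqP hx.
  by rewrite inE hx group1.
- exact: subsetT.
- by rewrite inE cycle_id.
- by rewrite -perp_sym.
Qed.

(* Up to a power, [a h ^ u, a y] depends only on h, and only on y. *)
Lemma nondeg_cycle u h1 y1 h2 y2 : nondeg p u ->
  y1 \notin perp u h1 -> y2 \notin perp u h2 ->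
  [~ a h2 ^ u, a y2] \in <[ [~ a h1 ^ u, a y1] ]>.
Proof.
move=> ndu n1 n2.
have [h [m1 m2]] : exists h, y1 \notin perp u h /\ y2 \notin perp u h.
  have [||h] := @notin_two_subgroups _ [group of perp u^-1 y1]
                  [group of perp u^-1 y2] h1 h2;
                    [by rewrite -(perp_sym a u) | by rewrite -(perp_sym a u)|].
  by case=> m1 m2; exists h; rewrite !(perp_sym a u h).
have e1 := nondeg_cyclel h ndu n1; have e2 := nondeg_cycler y2 ndu m1.
have e3 := nondeg_cyclel h2 ndu m2.
have tr (x v w : gT) : x \in <[v]> -> v \in <[w]> -> x \in <[w]>.
  by move=> xv vw; apply: subsetP xv; rewrite cycle_subG.
exact: tr e3 (tr _ _ _ e2 e1).
Qed.
End Prime.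
End Nondegenerate.

(** * Groups of order 16 and exponent 2 *)

Section WeakPair.
Variables (gT A B : finGroupType).
Variables (a : {morphism [set: A] >-> gT}) (b : {morphism [set: B] >-> gT}).
Variables (f : A -> B) (g : B -> A).
Hypotheses (cAA : abelian [set: A]) (cBB : abelian [set: B]).
Hypotheses (fK : cancel f g) (gK : cancel g f) (f1 : f 1 = 1).
Hypothesis abC : forall h, commute (a h) (b (f h)).
Local Notation perp := (perp a).
Local Notation rad := (rad a).
Implicit Types (h y z : A) (k : B).

Lemma inv_fix1 : g 1 = 1. Proof. by rewrite -f1 fK. Qed.

Lemma commute_inv k : commute (a (g k)) (b k).
Proof. by have := abC (g k); rewrite gK. Qed.

Lemma conj_mulf h k : a h ^ b (k * f h) = a h ^ b k.
Proof.
by rewrite (commute_abelian cBB) (morphTM b) conjgM (conjg_commute (abC h)).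
Qed.

Lemma conj_g k : a (g k) ^ b k = a (g k).
Proof. exact: conjg_commute (commute_inv k). Qed.

(** Left translation of [B] by [k], carried to [A] along [f]. It need not be a homomorphism, so it
    is exploited as an injection between finite sets. *)
Definition shift k h := g (k * f h).

Lemma f_shift k h : f (shift k h) = k * f h. Proof. exact: gK. Qed.

Lemma shift_inj k : injective (shift k).
Proof. by move=> h1 h2 /(can_inj gK)/mulgI/(can_inj fK). Qed.

Lemma shift1 k : shift k 1 = g k. Proof. by rewrite /shift f1 mulg1. Qed.

(** Both elements are conjugates under [b (k * f h)] of elements of the abelian image of [A]:
    [a (shift k h)] is even fixed by it. *)
Lemma shift_perp k h : shift k h \in perp (b k) h.
Proof.
apply/perpP; rewrite -conj_mulf -f_shift.
rewrite -[X in commute _ X](conjg_commute (abC (shift k h))).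
by apply: commuteJ; apply: commute_morph.
Qed.

Lemma g_rad k : g k \in rad (b k).
Proof.
by apply/radP=> h; apply/perpP; rewrite -conj_g; apply: commuteJ; apply: commute_morph.
Qed.

End WeakPair.

(** The elements [1], [r], [x], [y], [x * y] of [S] are distinct; [T] separates the last two from
    the others. *)
Lemma five_elements (C : finGroupType) (S T : {group C}) (r x y : C) :
    r \in S -> x \in S -> y \in S -> r != 1 -> x != 1 -> x != r ->
  r \in T -> x \in T -> y \notin T -> (4 < #|S|)%N.
Proof.
move=> Sr Sx Sy r1 x1 xr Tr Tx Ty.
have yT z : z \in T -> (y == z) = false by move=> Tz; apply: contraNF Ty => /eqP->.
have xyT z : z \in T -> (x * y == z) = false.
  by move=> Tz; apply: contraNF Ty => /eqP E; rewrite -(groupMl y Tx) E.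
have : [set x * y; y; x; r; 1] \subset S.
  by apply/subsetP=> z; rewrite !inE -!orbA => /or4P[| | |/orP[]] /eqP->; rewrite ?groupM.
move/subset_leq_card; apply: leq_trans.
have xyy : (x * y == y) = false by rewrite -{2}[y]mul1g (inj_eq (mulIg y)) (negPf x1).
rewrite -!setUA !cardsU1 cards1 !inE xyy (xyT _ Tx) (xyT _ Tr) (xyT _ (group1 T)).
rewrite (yT _ Tx) (yT _ Tr) (yT _ (group1 T)).
by rewrite (negPf x1) (negPf xr) (negPf r1).
Qed.

Lemma large_subgroup (C : finGroupType) (S : {group C}) :
  #|C| = 16 -> (8 < #|S|)%N -> S = [set: C] :> {set C}.
Proof.
move=> oC S8; apply/eqP; rewrite eqEcard subsetT cardsT oC /=.
have := cardSg (subsetT S); rewrite cardsT oC.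
by move: #|S| S8 => m m8 /dvdnP[[|[|q]] E]; rewrite ?mulSn ?mul0n in E; lia.
Qed.

Lemma card_subgroup16 (C : finGroupType) (S : {group C}) :
  #|C| = 16 -> #|S| \in [:: 1; 2; 4; 8; 16]%N.
Proof.
move=> oC; have := cardSg (subsetT S); rewrite cardsT oC.
by rewrite dvdn_divisors.
Qed.

Lemma involution_comm (gT : finGroupType) (x u : gT) :
  x^-1 = x -> u^-1 = u -> [~ x, u] ^ x = [~ x, u]^-1 /\ [~ x, u] ^ u = [~ x, u]^-1.
Proof.
move=> xV uV; rewrite invgR /commg /conjg xV uV !mulgA.
have xx : x * x = 1 by rewrite -{1}xV mulVg.
have uu : u * u = 1 by rewrite -{1}uV mulVg.
by rewrite xx mul1g -[_ * u * u]mulgA uu mulg1.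
Qed.

Lemma cancel_pairs (gT : finGroupType) (p q p' q' w d : gT) :
    p * q = 1 -> p' * q' = 1 -> commute w q -> commute w p' -> commute d q' ->
  p' * (p * w) * (q * d * q') = 1 -> w * d = 1.
Proof.
move=> pq p'q' cq cp cd; rewrite -(mulgA q) cd -!mulgA (mulgA w) cq -mulgA.
by rewrite (mulgA p) pq mul1g (mulgA p') -cp -mulgA (mulgA p') p'q' mul1g.
Qed.

Section TwoGroups.
Variables (gT A B : finGroupType).
Variables (a : {morphism [set: A] >-> gT}) (b : {morphism [set: B] >-> gT}).
Variables (f : A -> B) (g : B -> A).
Hypotheses (A2 : forall x : A, x * x = 1) (B2 : forall x : B, x * x = 1).
Hypothesis oA : #|A| = 16.
Hypotheses (fK : cancel f g) (gK : cancel g f) (f1 : f 1 = 1).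
Hypothesis abC : forall h, commute (a h) (b (f h)).
Local Notation perp := (perp a).
Local Notation rad := (rad a).
Implicit Types (h y z : A) (k : B).

Lemma exp2_inv (C : finGroupType) (C2 : forall x : C, x * x = 1) (x : C) : x^-1 = x.
Proof. by apply: (mulgI x); rewrite mulgV C2. Qed.

Lemma exp2_abelian (C : finGroupType) (C2 : forall x : C, x * x = 1) : abelian [set: C].
Proof.
by apply/centsP=> x _ y _; rewrite /commute -[x * y](exp2_inv C2) invMg !(exp2_inv C2).
Qed.

Let cAA := exp2_abelian A2.
Let cBB := exp2_abelian B2.
Local Notation s := (shift f g).
Let sP k h : s k h \in perp (b k) h := shift_perp cAA cBB gK abC k h.
Let sI k : injective (s k) := shift_inj fK gK (k := k).
Let aC1 := commute_morph a cAA.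

Lemma shiftK k : involutive (s k).
Proof. by move=> h; rewrite {1}/shift (f_shift gK) mulgA B2 mul1g fK. Qed.

Let bV k : (b k)^-1 = b k. Proof. by rewrite -(morphTV b) (exp2_inv B2). Qed.

Lemma perp_symV u h y : u^-1 = u -> (y \in perp u h) = (h \in perp u y).
Proof. by move=> uV; rewrite perp_sym uV. Qed.

Lemma perp_symb k h y : (y \in perp (b k) h) = (h \in perp (b k) y).
Proof. exact/perp_symV/bV. Qed.

Lemma conj_invol y k : (a y ^ b k)^-1 = a y ^ b k.
Proof. by rewrite -conjVg -(morphTV a) (exp2_inv A2). Qed.

Lemma card_B : #|B| = 16.
Proof. by rewrite -oA; apply/esym/bij_eq_card; exists g. Qed.

Definition csupp w := [set x : B | [forall h, [~ w, a h ^ b x] == 1]].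

Lemma csuppP w x : reflect (forall h, commute w (a h ^ b x)) (x \in csupp w).
Proof. by rewrite inE; apply: (iffP forallP) => c h; apply/commgP/c. Qed.

(* For [k] in [csupp w] the element [g (x * k)] is fixed by [b (x * k)], so its
   conjugates under [b x] and [b k] agree. *)
Lemma csupp_full w : (8 <= #|csupp w|)%N -> forall x h, commute w (a h ^ b x).
Proof.
move=> X8 x h; case: (boolP (x \in csupp w)) => [/csuppP|nx]; first exact.
pose S := (a @*^-1 'C[w ^ (b x)^-1])%G.
have SP v : reflect (commute w (a v ^ b x)) (v \in S).
  apply: (iffP (mem_precent1 _ _ _)) => [/commuteJl|c]; first by rewrite invgK.
  by apply/commuteJl; rewrite invgK.
suff ST : S = [set: A] :> {set A}.
  by apply/SP; have: h \in (S : {set A}) by rewrite ST inE.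
apply: large_subgroup => //.
pose F := (fun k => g (x * k)) @: csupp w.
have oF : #|F| = #|csupp w|.
  by apply: card_imset => k1 k2 /(can_inj gK)/mulgI.
have F1 : 1 \notin F.
  apply: contra nx => /imsetP[k Xk] /(congr1 f); rewrite f1 gK => /eqP.
  by rewrite eq_sym -eq_invg_mul (exp2_inv B2) => /eqP->.
apply: leq_trans (subset_leq_card (_ : 1 |: F \subset S)).
  by rewrite cardsU1 F1 oF ltnS.
apply/subsetP=> _ /setU1P[->|/imsetP[k Xk ->]]; first exact: group1.
apply/SP; have -> : a (g (x * k)) ^ b x = a (g (x * k)) ^ b k.
  by rewrite -[in LHS](conj_g gK abC) -conjgM -(morphTM b) (commute_abelian cBB x)
    -mulgA B2 mulg1.
exact: csuppP.
Qed.

(** Three distinct members are [1], [g k] and [s k h], and the order is a power of 2. *)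
Lemma perp_size k h : k != 1 -> h != 1 -> h != g k -> (4 <= #|perp (b k) h|)%N.
Proof.
move=> k1 h1 hk.
have : [set 1; g k; s k h] \subset perp (b k) h.
  apply/subsetP=> v; rewrite !in_setU !in_set1 -orbA => /or3P[] /eqP->.
  - exact: (group1 [group of perp (b k) h]).
  - exact: (subsetP (rad_sub _ _ _) _ (g_rad cAA gK abC k)).
  - exact: sP.
have gk1 : g k != 1.
  by apply: contraNneq k1 => /(congr1 f); rewrite gK f1 => ->.
have sk1 : s k h != 1.
  apply: contraNneq hk => /(congr1 f); rewrite (f_shift gK) f1 => /eqP.
  by rewrite -eq_invg_mul (exp2_inv B2) => /eqP->; rewrite fK.
have sk2 : s k h != g k.
  apply: contraNneq h1 => /(can_inj gK)/(canRL (mulKg k)); rewrite mulVg => E.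
  by rewrite -(fK h) E (inv_fix1 fK f1).
move/subset_leq_card; rewrite -setUA cardsU1 cards2 !inE.
rewrite eq_sym (negPf gk1) eq_sym (negPf sk1) eq_sym sk2 /=.
have := card_subgroup16 [group of perp (b k) h] oA; rewrite !inE /=.
by case/or4P=> [||| /orP[]] /eqP->.
Qed.

(** If [a v] commutes with [u = a y ^ b k], then [a v] is its own conjugate under [u] and so
    commutes with every [a h ^ u]. *)
Lemma perp_sub_rad k y : perp (b k) y \subset rad (a y ^ b k).
Proof.
apply/subsetP=> v /perpP cyv; apply/radP=> h; apply/perpP.
by rewrite -(conjg_commute (commute_sym cyv)); apply: commuteJ.
Qed.

(** For [x] outside the radical, the orders satisfy 4 <= |perp (b k) y| <= |rad u| < |perp u x| <
    16; being powers of 2 they are 4, 4 and 8. *)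
Lemma rad_dichotomy k y : rad (a y ^ b k) != [set: A] ->
  [/\ nondeg a 2 (a y ^ b k), rad (a y ^ b k) = perp (b k) y
    & #|perp (b k) y| = 4].
Proof.
set u := a y ^ b k => nfull; have uV : u^-1 = u by apply: conj_invol.
have full_u : (forall z, commute u (a z)) -> rad u = [set: A].
  move=> cu; apply/setP=> z; rewrite inE; apply/radP=> h; apply/perpP.
  by rewrite (conjg_commute (commute_sym (cu h))).
have k1 : k != 1.
  by apply: contraNneq nfull => k1; rewrite full_u // => z; rewrite /u k1 morph1 conjg1.
have y1 : y != 1.
  apply: contraNneq nfull => y1; rewrite full_u // => z.
  by rewrite /u y1 morph1 conj1g; apply/commute_sym/commute1.
have yk : y != g k.
  apply: contraNneq nfull => yk; rewrite full_u // => z.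
  by rewrite /u yk (conj_g gK abC).
have sR : perp (b k) y \subset rad u := perp_sub_rad k y.
(* The analogue of [s k] for conjugation by [u]. Since [a h] commutes with [a (s k h) ^ b k], it has
   the same conjugate under [u] as under [a (y * s k h) ^ b k], and the latter fixes [a (s' h)]. *)
pose s' h := s k (y * s k h).
have s'I : injective s' by move=> h1 h2 /sI/mulgI/sI.
have s'P h : s' h \in perp u h.
  have ch : commute (a h) (a (s k h) ^ b k).
    by have /perpP/commuteJl := sP k h; rewrite bV.
  have hu : a h ^ u = a h ^ (a (y * s k h) ^ b k).
    by rewrite (commute_abelian cAA y) (morphTM a) conjMg [RHS]conjgM (conjg_commute ch).
  apply/perpP; rewrite hu.
  have /perpP/commute_sym/conjg_commute <- := sP k (y * s k h).
  exact: commuteJ.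
have R_r : g k \in rad u.
  by apply/(subsetP sR)/(subsetP (rad_sub _ _ _))/(g_rad cAA gK abC).
have R_s : s k y \in rad u by apply: (subsetP sR).
have perp_mulr x v : v \in rad u -> perp u (x * v) = perp u x.
  move=> /radP Rv; apply/setP=> z; rewrite perp_symV // [RHS]perp_symV //.
  by apply: (groupMr x (Rv z : v \in [group of perp u z])).
(* In case of equality [s'] maps the coset [x *: rad u] onto [rad u]. But [rad u] contains
   [g k = s' (s k y)], and [s k y] lies in [rad u] itself, not in that coset. *)
have properR x : x \notin rad u -> rad u \proper perp u x.
  move=> Rx; rewrite properEneq rad_sub andbT; apply: contra Rx => /eqP E.
  have sF : s' @: (x *: rad u) \subset rad u.
    apply/subsetP=> _ /imsetP[_ /lcosetP[v Rv ->] ->].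
    by rewrite E -(perp_mulr x v Rv) s'P.
  have /eqP F : s' @: (x *: rad u) == rad u.
    by rewrite eqEcard sF card_imset // card_lcoset leqnn.
  have : g k \in s' @: (x *: rad u) by rewrite F.
  case/imsetP=> _ /lcosetP[v Rv ->] Ev.
  have /s'I E1 : s' (s k y) = s' (x * v).
    by rewrite -Ev /s' shiftK A2 (shift1 g f1).
  by move: R_s; rewrite E1 groupMr.
have properT x : x \notin rad u -> perp u x \proper [set: A].
  move=> Rx; rewrite properT; apply: contra Rx => /eqP E.
  by apply/radP=> h; rewrite perp_symV // E inE.
have [x _ Rx] : exists2 x, x \in [set: A] & x \notin rad u.
  by apply/subsetPn; rewrite subTset.
have sz : #|perp (b k) y| = 4 /\ #|rad u| = 4.
  have := perp_size k1 y1 yk; have := subset_leq_card sR.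
  have := proper_card (properR x Rx); have := proper_card (properT x Rx).
  have := card_subgroup16 [group of rad u] oA;
    have := card_subgroup16 [group of perp u x] oA.
  have := card_subgroup16 [group of perp (b k) y] oA.
  by rewrite cardsT oA !inE /=; do 3![case/or4P=> [||| /orP[]] /eqP->].
have [oP oR] := sz.
have size8 z : z \notin rad u -> #|perp u z| = 8.
  move=> Rz; have := proper_card (properR z Rz); have := proper_card (properT z Rz).
  have := card_subgroup16 [group of perp u z] oA; rewrite cardsT oA oR !inE /=.
  by case/or4P=> [||| /orP[]] /eqP->.
split=> //; first by split; rewrite ?uV ?cardsT ?oR.
by apply/esym/eqP; rewrite eqEcard sR oP oR.
Qed.

(* [D] is the only nontrivial value of the triple commutators [h, y^k, z]. *)
Definition triple k y D :=
  [/\ [/\ D != 1, D * D = 1, forall z, commute D (a z) & D ^ (a y ^ b k) = D],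
      forall h z, [~ a h ^ (a y ^ b k), a z]
                    = if z \in perp (a y ^ b k) h then 1 else D
    & [/\ nondeg a 2 (a y ^ b k), rad (a y ^ b k) = perp (b k) y
        & #|perp (b k) y| = 4]].

Lemma tripleI k y h z : z \notin perp (a y ^ b k) h ->
  triple k y [~ a h ^ (a y ^ b k), a z].
Proof.
set u := a y ^ b k => nhz; set D := [~ _, _].
have uV : u^-1 = u by apply: conj_invol.
have nfull : rad u != [set: A].
  by apply: contra nhz => /eqP E; have /radP : z \in rad u by rewrite E inE.
have [ndu Ru oP] := rad_dichotomy nfull.
have cD w : commute D (a w) by apply: nondeg_comm_cent ndu.
have D1 : D != 1 by rewrite -perpN.
have D2 : D * D = 1.
  have: [~ a h ^ u, a (z * z)] = 1 by rewrite A2 morph1 commg1.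
  by rewrite (morphTM a) commgMJ -/D (conjg_commute (cD z)).
have oD : #[D] = 2.
  by apply: nt_prime_order => //; rewrite expgS expg1.
have valD h1 z1 : [~ a h1 ^ u, a z1] = if z1 \in perp u h1 then 1 else D.
  have [/perpP/commgP/eqP//|n1] := boolP (z1 \in perp u h1).
  have := nondeg_cycle cAA (isT : prime 2) ndu nhz n1.
  by rewrite perpN in n1; rewrite -/D cycle2g // !inE (negPf n1) => /eqP.
split=> //; split=> //.
(* As [u] is its own inverse, the relation is symmetric and [D] is also the value with [h] and [z]
   exchanged; conjugation by [u] performs this exchange up to inversion, so it fixes [D]. *)
have Dsym : [~ a z ^ u, a h] = D by rewrite valD -perp_symV // (negPf nhz).
have /eqP DV : D^-1 == D by rewrite eq_invg_mul D2.
have uu : u * u = 1 by rewrite -{1}uV mulVg.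
by rewrite {1}/D conjRg -conjgM uu conjg1 -invgR Dsym.
Qed.

Lemma triple_comm k y D h z : triple k y D ->
  [~ [~ a h, a y ^ b k], a z] = if z \in perp (a y ^ b k) h then 1 else D.
Proof.
by case=> _ valD _; rewrite -valD comm_commg.
Qed.

Lemma triple_uniq k y D h z : triple k y D -> z \notin perp (a y ^ b k) h ->
  [~ a h ^ (a y ^ b k), a z] = D.
Proof. by case=> _ -> _ /negPf->. Qed.

Lemma triple_wit k y D h : triple k y D -> h \notin perp (b k) y ->
  exists2 z, z \notin perp (a y ^ b k) h & [~ [~ a h, a y ^ b k], a z] = D.
Proof.
move=> tD; have [_ _ [_ Ru _]] := tD; rewrite -Ru => Rh.
have [z nz] : exists z, z \notin perp (a y ^ b k) h.
  apply/existsP; rewrite -negb_forall; apply: contra Rh => /forallP E.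
  by apply/radP=> z; rewrite perp_symV ?conj_invol.
by exists z => //; rewrite (triple_comm _ _ tD) (negPf nz).
Qed.

Lemma comm_mul_perp k h y v : v \in perp (b k) h ->
  [~ a h, a (y * v) ^ b k] = [~ a h, a y ^ b k].
Proof.
move=> /perpP/commuteJl; rewrite bV => chv.
rewrite (morphTM a) conjMg commgMJ (eqP (introT commgP chv)) mul1g conjRg.
by rewrite (conjg_commute chv) (conjg_commute (commuteJ _ (aC1 y v))).
Qed.

(** When [v^k] commutes with [h], the commutators of [h] with [y^k] and with [(y * v)^k] agree, so
    the same [D] arises. Taking [v = s k h] moves a triple from [y] to many other elements. *)
Lemma triple_mul k y D h v : triple k y D -> h \notin perp (b k) y ->
  v \in perp (b k) h -> triple k (y * v) D.
Proof.
move=> tD nh hv; have [z _ Dz] := triple_wit tD nh.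
have [[D1 _ _ _] _ _] := tD.
have nz : z \notin perp (a (y * v) ^ b k) h.
  apply: contra D1 => /perpP/commgP/eqP c1; rewrite -Dz -(comm_mul_perp y hv).
  by rewrite comm_commg // c1.
suff -> : D = [~ a h ^ (a (y * v) ^ b k), a z] by apply: tripleI.
by rewrite -Dz -(comm_mul_perp y hv) comm_commg.
Qed.

(** [D] commutes with [a y ^ b k] and with [a (y * s k h) ^ b k], hence with [a (s k h) ^ b k], for
    the 12 elements [h] outside [perp (b k) y]; 12 exceeds 8. *)
Lemma triple_cent k y D z : triple k y D -> commute D (a z ^ b k).
Proof.
move=> tD; have [[_ _ _ Du] _ [_ _ oP]] := tD.
pose S := (a @*^-1 'C[D ^ (b k)^-1])%G.
have SP v : reflect (commute D (a v ^ b k)) (v \in S).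
  apply: (iffP (mem_precent1 _ _ _)) => [/commuteJl|c]; first by rewrite invgK.
  by apply/commuteJl; rewrite invgK.
suff ST : S = [set: A] :> {set A}.
  by apply/SP; have: z \in (S : {set A}) by rewrite ST inE.
apply: large_subgroup => //.
have: s k @: (~: perp (b k) y) \subset S.
  apply/subsetP=> _ /imsetP[h + ->]; rewrite in_setC => nh; apply/SP.
  have [[_ _ _ Dv] _ _] := triple_mul tD nh (sP k h).
  rewrite -[s k h](mulKg y) (exp2_inv A2) (morphTM a) conjMg.
  by apply: commuteM; apply/commute_conjg.
move/subset_leq_card; rewrite card_imset; last exact: sI.
by apply: leq_trans; rewrite cardsCs setCK oA oP.
Qed.

Lemma triple_mulf k y D : triple k y D -> triple (k * f y) y D.
Proof.
have E : perp (b (k * f y)) y = perp (b k) y.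
  by congr (_ @*^-1 'C[_]); apply: (conj_mulf cBB abC).
by rewrite /triple E (conj_mulf cBB abC).
Qed.

Lemma card_perpC k y D : triple k y D -> #|~: perp (b k) y| = 12.
Proof. by case=> _ _ [_ _ oP]; rewrite cardsCs setCK oA oP. Qed.

(** With [y' = y * s k h], [D] also belongs to a triple for [k * f y']. This puts 12 elements into
    [csupp D], and [csupp_full] asks for 8. *)
Lemma triple_centX k y D z x : triple k y D -> commute D (a z ^ b x).
Proof.
move=> tD; apply: csupp_full.
pose F h := k * f (y * s k h).
have FI : injective F by move=> h1 h2 /mulgI/(can_inj fK)/mulgI/sI.
suff : F @: (~: perp (b k) y) \subset csupp D.
  by move/subset_leq_card; rewrite card_imset // (card_perpC tD); apply: leq_trans.
apply/subsetP=> _ /imsetP[h + ->]; rewrite in_setC => nh; apply/csuppP=> h'.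
exact/triple_cent/triple_mulf/(triple_mul tD nh)/sP.
Qed.

Lemma triple_k1 k y D : triple k y D -> k != 1.
Proof.
case=> _ _ [_ _ oP]; apply/eqP=> k1.
suff E : perp (b k) y = [set: A] by rewrite E cardsT oA in oP.
by apply/setP=> z; rewrite in_setT; apply/perpP; rewrite k1 morph1 conjg1.
Qed.

Lemma g_neq1 k : k != 1 -> g k != 1.
Proof. by apply: contraNneq => /(congr1 f); rewrite gK f1 => ->. Qed.

Definition tripleb k D y :=
  [exists h, exists z, [~ a h ^ (a y ^ b k), a z] == D].

Lemma triplebP k y D : D != 1 -> reflect (triple k y D) (tripleb k D y).
Proof.
move=> D1; apply: (iffP existsP) => [[h /existsP[z /eqP E]]|tD].
  by rewrite -E; apply: tripleI; rewrite perpN E.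
have [h nh] : exists h, h \notin perp (b k) y.
  apply/existsP; rewrite -negb_forall; apply/forallP=> E.
  have := card_perpC tD; rewrite (_ : ~: _ = set0) ?cards0 //.
  by apply/setP=> z; rewrite in_setC E inE.
have [z nz _] := triple_wit tD nh.
by exists h; apply/existsP; exists z; rewrite (triple_uniq tD).
Qed.

(** At least 12 elements have the property. An exception [y] would be perpendicular to 12 elements,
    hence to all, and so enlarge [rad (b k)] to order 4. Then [rad (b k) = perp (b k) z] for each of
    the 12 elements [z], and [s k] would inject them into it. *)
Lemma triple_all k y0 D y : triple k y0 D -> y != 1 -> y != g k -> triple k y D.
Proof.
move=> t0 y1 yk; have [[D1 _ _ _] _ _] := t0.
pose Y := [set y | tripleb k D y].
have YP z : reflect (triple k z D) (z \in Y) by rewrite inE; apply: triplebP.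
have oY : (12 <= #|Y|)%N.
  pose F h := y0 * s k h.
  have FI : injective F by move=> h1 h2 /mulgI/sI.
  rewrite -(card_perpC t0) -(card_imset _ FI); apply: subset_leq_card.
  apply/subsetP=> _ /imsetP[h + ->]; rewrite in_setC => nh.
  by apply/YP/(triple_mul t0 nh)/sP.
apply/YP; apply/negPn/negP=> nYy.
(* If [h = s k (z * y)] were not perpendicular to [z], [triple_mul] would carry the triple from [z]
   to [z * s k h = y]. So [h] is perpendicular to [z] and to [z * y], hence to [y]. *)
have key z : z \in Y -> s k (z * y) \in perp (b k) y.
  move=> /YP tz; have sz := sP k (z * y); set h := s k _ in sz *.
  have zh : h \in perp (b k) z.
    apply: contraR nYy => nh; apply/YP.
    have := triple_mul tz nh (sP k h).
    by rewrite /h shiftK mulgA A2 mul1g.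
  rewrite perp_symb in sz; rewrite perp_symb in zh; rewrite perp_symb.
  by rewrite -(groupMl _ (zh : z \in [group of perp (b k) h])).
have T : perp (b k) y = [set: A].
  apply: (@large_subgroup _ [group of perp (b k) y]) => //.
  pose F z := s k (z * y).
  have FI : injective F by move=> h1 h2 /sI/mulIg.
  apply: (@leq_trans 12) => //; apply: leq_trans oY _.
  rewrite -(card_imset _ FI); apply: subset_leq_card.
  by apply/subsetP=> _ /imsetP[z Yz ->]; apply: key.
have Ry : y \in rad (b k) by apply/radP=> h; rewrite perp_symb T inE.
have oR : (4 <= #|rad (b k)|)%N.
  have : [set 1; g k; y] \subset rad (b k).
    apply/subsetP=> v; rewrite !in_setU !in_set1 -orbA => /or3P[] /eqP->.
    - exact: (group1 [group of rad (b k)]).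
    - exact: g_rad.
    - exact: Ry.
  move/subset_leq_card; rewrite -setUA cardsU1 cards2 !inE.
  rewrite eq_sym (negPf (g_neq1 (triple_k1 t0))) eq_sym (negPf y1) eq_sym yk /=.
  by have := card_subgroup16 [group of rad (b k)] oA; rewrite !inE;
    case/or4P=> [||| /orP[]] /eqP->.
have : s k @: Y \subset rad (b k).
  apply/subsetP=> _ /imsetP[z /YP tz ->].
  have [_ _ [_ _ oP]] := tz.
  suff -> : rad (b k) = perp (b k) z by apply: sP.
  by apply/eqP; rewrite eqEcard rad_sub oP.
have [_ _ [_ _ oP]] := t0.
move/subset_leq_card; rewrite card_imset; last exact: sI.
have := subset_leq_card (rad_sub a (b k) y0); rewrite oP.
by move=> le4 /leq_trans/(_ le4)/(leq_trans oY).
Qed.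

(** * The trilinear form of the triple commutators, and invariance of [D] under [b k] *)

Section Triple.
Variables (k : B) (y0 : A) (D : gT).
Hypothesis tD : triple k y0 D.

Let E h y := [~ a h, a y ^ b k].
(** With booleans read as F_2, this is a trilinear form on [A], symmetric in its outer arguments;
    [eps] turns its values into powers of [D]. *)
Let t h y z := z \notin perp (a y ^ b k) h.
Let eps c : gT := if c then D else 1.

Let D1 : D != 1. Proof. by case: tD => [[]]. Qed.
Let D2 : D * D = 1. Proof. by case: tD => [[]]. Qed.
Let cD z x : commute D (a z ^ b x). Proof. exact: triple_centX tD. Qed.
Let cDa z : commute D (a z). Proof. by case: tD => [[]]. Qed.

Let eps_cent c w : commute D w -> commute (eps c) w.
Proof. by case: c => //= _; apply/commute_sym/commute1. Qed.

Let epsV c : (eps c)^-1 = eps c.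
Proof. by case: c; rewrite /= ?invg1 //; apply: mulgg1_inv. Qed.

Let eps_add c d : eps c * eps d = eps (c (+) d).
Proof. by case: c d => [] [] /=; rewrite ?D2 ?mulg1 ?mul1g. Qed.

Let eps_inj : injective eps.
Proof. by case=> [] [] //= E1; case/eqP: D1. Qed.

Let uV y : (a y ^ b k)^-1 = a y ^ b k := conj_invol y k.

Let tsym h y z : t h y z = t z y h.
Proof. by rewrite /t perp_symV. Qed.

Let perp_t h y z : h \in perp (b k) y -> t h y z = false.
Proof.
move=> ph; apply: negbTE; rewrite negbK perp_symV //.
by have /radP := subsetP (perp_sub_rad k y) _ ph.
Qed.

(** [a h] and [a y ^ b k] are their own inverses, so both invert their commutator [E h y], and both
    sides equal its square inverted. *)
Let EV h y : [~ E h y, a y ^ b k] = [~ E h y, a h].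
Proof.
have aV2 : (a h)^-1 = a h by rewrite -(morphTV a) (exp2_inv A2).
have [E1 E2] := involution_comm aV2 (uV y).
by rewrite commgEl [RHS]commgEl E1 E2.
Qed.

Let cval h y z : [~ E h y, a z] = eps (t h y z).
Proof.
have [ok|] := boolP ((y != 1) && (y != g k)).
  have ty : triple k y D by case/andP: ok; apply: triple_all tD.
  by rewrite (triple_comm _ _ ty) /t; case: (_ \in _).
rewrite negb_and !negbK => ok.
have R : perp (b k) y = [set: A].
  apply/setP=> v; rewrite in_setT perp_symb.
  case/orP: ok => /eqP->; first exact: (group1 [group of perp (b k) v]).
  exact: (subsetP (rad_sub _ _ _) _ (g_rad cAA gK abC k)).
have /perpP/commute_sym/commgP/eqP Ehy : h \in perp (b k) y by rewrite R in_setT.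
by rewrite /E Ehy comm1g perp_t // R in_setT.
Qed.

Let t_mulh h1 h2 y z : t (h1 * h2) y z = t h1 y z (+) t h2 y z.
Proof.
apply: eps_inj; rewrite -eps_add -!cval !comm_commg // (morphTM a) conjMg commMgJ.
congr (_ * _); rewrite -comm_commg // cval; apply/conjg_commute/eps_cent.
by apply: commute_conj2.
Qed.

Let bkbk : b k * b k = 1. Proof. by rewrite -{1}bV mulVg. Qed.

Let EJ h y : E h y ^ b k = (E y h)^-1.
Proof. by rewrite conjRg -conjgM bkbk conjg1 invgR. Qed.

Let cE h y c : commute (eps c) (E h y).
Proof. by apply: commute_comm; apply: eps_cent. Qed.

(** Conjugation by [b k] exchanges the arguments of [E] up to inversion. This is where the conjugate
    of [D] under [b k] enters. *)
Let cvalJ h y z : [~ E h y, a z ^ b k] = eps (t y h z) ^ b k.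
Proof.
rewrite -[E h y]conjg1 -bkbk conjgM EJ -conjRg; congr (_ ^ _).
rewrite commgEl invgK conjVg -[E y h ^ _](mulKVg (E y h)) -commgEl cval invMg epsV.
by rewrite mulgA -(cE y h) mulgK.
Qed.

Let epsJ_cent c z x : commute (eps c ^ b k) (a z ^ b x).
Proof.
apply/commuteJl; rewrite -conjgM -(morphTV b) -(morphTM b).
exact: eps_cent.
Qed.

Let epsJ_cent_a c x : commute (eps c ^ b k) (a x).
Proof. by have := epsJ_cent c x 1; rewrite morph1 conjg1. Qed.

Let epsJE c h y : commute (eps c ^ b k) (E h y).
Proof. by apply: commute_comm; [apply: epsJ_cent_a | apply: epsJ_cent]. Qed.

Let eps_epsJ c d : commute (eps c ^ b k) (eps d).
Proof.
case: d => /=; last exact: commute1.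
have [h nh] : exists h, h \notin perp (b k) y0.
  apply/existsP; rewrite -negb_forall; apply/forallP=> R.
  have := card_perpC tD; rewrite (_ : ~: _ = set0) ?cards0 //.
  by apply/setP=> z; rewrite in_setC R inE.
have [z _ <-] := triple_wit tD nh.
by apply: commute_comm; [apply: epsJE | apply: epsJ_cent_a].
Qed.

Let E_mulr h y1 y2 :
  E h (y1 * y2) = E h y2 * (E h y1 * eps (t y1 h y2) ^ b k).
Proof.
rewrite /E (morphTM a) conjMg commgMJ -/(E _ _) -/(E _ _); congr (_ * _).
by rewrite -[E h y1 ^ _](mulKVg (E h y1)) -commgEl cvalJ.
Qed.

Let E_mull h1 h2 y : E (h1 * h2) y = E h1 y * eps (t h1 y h2) * E h2 y.
Proof.
rewrite /E (morphTM a) commMgJ -/(E _ _) -/(E _ _); congr (_ * _).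
by rewrite -[E h1 y ^ _](mulKVg (E h1 y)) -commgEl cval.
Qed.

Let t_mulr h y1 y2 z : t h (y1 * y2) z = t h y1 z (+) t h y2 z.
Proof.
apply: eps_inj; rewrite -eps_add -(cval _ (y1 * y2)) E_mulr.
set w := eps _ ^ _.
rewrite (commMgJ (E h y2)) (commMgJ (E h y1)) !cval (eqP (introT commgP (epsJ_cent_a (t
  y1 h y2) z))) mulg1.
rewrite (conjg_commute (commute_sym (eps_epsJ _ _))).
rewrite (conjg_commute (_ : commute _ (_ * w))); first by rewrite eps_add addbC.
by apply: commuteM; [apply: cE | apply/commute_sym/eps_epsJ].
Qed.

Let r := g k.
Let r1 : r != 1. Proof. exact/g_neq1/triple_k1/tD. Qed.
Let Rr : r \in rad (b k). Proof. exact: g_rad. Qed.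
Let perp_r h : r \in perp (b k) h. Proof. by have /radP := Rr. Qed.

Let tripleY y : y != 1 -> y != r -> triple k y D. Proof. exact: triple_all tD. Qed.

Let perp_ne h y : h \notin perp (b k) y -> y != 1 /\ y != r.
Proof.
move=> nh; split; apply: contraNneq nh => ->; by rewrite perp_symb ?perp_r.
Qed.

Let perp_neh h y : h \notin perp (b k) y -> h != 1 /\ h != r.
Proof. by rewrite perp_symb; apply: perp_ne. Qed.

Section Alternating.
Hypothesis alt : forall h y, t h y h = false.

(** Expanding [t (x1 * x2) (y1 * y2) z] leaves [t x1 y2 z] and [t x2 y1 z], which cancel: their
    kernels in [z] have order 8 and share more than 4 elements, since alternation puts [r], [x1] and
    [x2] into both. *)
Let perpM x1 y1 x2 y2 :
    y1 \in perp (b k) x1 -> y2 \in perp (b k) x2 ->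
    x2 \notin perp (b k) y1 -> x1 \notin perp (b k) y2 ->
  y1 * y2 \in perp (b k) (x1 * x2).
Proof.
move=> P1 P2 n21 n12.
have [y1n1 y1nr] := perp_ne n21; have [y2n1 y2nr] := perp_ne n12.
have [E1|yn1] := eqVneq (y1 * y2) 1; first by rewrite E1 (group1 [group of perp _ _]).
have [E1|ynr] := eqVneq (y1 * y2) r; first by rewrite E1.
have [_ _ [_ RY _]] := tripleY yn1 ynr; rewrite perp_symb -RY.
apply/radP=> z; rewrite perp_symV // -[_ \in _]negbK -/(t _ _ _) t_mulr !t_mulh.
have P1' : x1 \in perp (b k) y1 by rewrite perp_symb.
have P2' : x2 \in perp (b k) y2 by rewrite perp_symb.
rewrite (perp_t _ P1') (perp_t _ P2') /= addbF.
suff -> : t x2 y1 z = t x1 y2 z by rewrite addbb.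
suff E12 : perp (a y1 ^ b k) x2 = perp (a y2 ^ b k) x1 by rewrite /t E12.
have [_ _ [[_ _ sz1 _] R1 o1]] := tripleY y1n1 y1nr.
have [_ _ [[_ _ sz2 _] R2 o2]] := tripleY y2n1 y2nr.
pose S1 := [group of perp (a y1 ^ b k) x2]; pose S2 := [group of perp (a y2 ^ b k) x1].
have oS1 : #|S1| = 8 by rewrite sz1 ?uV ?R1 // o1.
have oS2 : #|S2| = 8 by rewrite sz2 ?uV ?R2 // o2.
have x1n1 : x1 != 1.
  by apply: contraNneq n12 => ->; apply: (group1 [group of perp (b k) y2]).
have x1nr : x1 != r by apply: contraNneq n12 => ->.
have o5 : (4 < #|(S1 :&: S2)%G|)%N.
  apply: (@five_elements _ _ [group of perp (b k) y1] r x1 x2) => //=.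
  - by rewrite inE !(subsetP (rad_sub _ _ _)) ?R1 ?R2 ?perp_r.
  - rewrite inE (subsetP (rad_sub _ _ _)) ?R1 //=.
    by have := alt x1 y2; rewrite /t => /negbFE.
  - rewrite inE andbC (subsetP (rad_sub _ _ _)) ?R2 //=.
    by have := alt x2 y1; rewrite /t => /negbFE.
have o8 : #|(S1 :&: S2)%G| = 8.
  have := subset_leq_card (subsetIl S1 S2); move: o5; rewrite oS1.
  by have := card_subgroup16 (S1 :&: S2)%G oA; rewrite !inE;
    case/or4P=> [||| /orP[]] /eqP->.
have ES1 : S1 :&: S2 = S1 by apply/eqP; rewrite eqEcard subsetIl o8 oS1.
have ES2 : S1 :&: S2 = S2 by apply/eqP; rewrite eqEcard subsetIr o8 oS2.
by rewrite -[LHS]ES1 ES2.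
Qed.

(** By [perpM], [E (x1 * x2) (y1 * y2) = 1]. In its expansion the terms [E x1 y1], [E x2 y2] are
    trivial, and every correction [eps] vanishes because it involves one of the two perpendicular
    pairs. *)
Let E_swap x1 y1 x2 y2 :
    y1 \in perp (b k) x1 -> y2 \in perp (b k) x2 ->
    x2 \notin perp (b k) y1 -> x1 \notin perp (b k) y2 ->
  E x1 y2 * E x2 y1 = 1.
Proof.
move=> P1 P2 n21 n12; have P12 := perpM P1 P2 n21 n12.
have E0 x y : y \in perp (b k) x -> E x y = 1.
  by rewrite perp_symb => /perpP/commute_sym/commgP/eqP.
have P1' : x1 \in perp (b k) y1 by rewrite perp_symb.
have P2' : x2 \in perp (b k) y2 by rewrite perp_symb.
have := E0 _ _ P12; rewrite E_mulr !E_mull (E0 _ _ P1) (E0 _ _ P2) t_mulr.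
rewrite (perp_t _ P1') (perp_t _ P1) [t x1 y2 x2]tsym (perp_t _ P2').
by rewrite [t y1 x2 y2]tsym (perp_t _ P2) /= conj1g !mulg1 mul1g.
Qed.

(** Take [x1], [x2], [x3] and [y1], [y2], [y3] with [xi] perpendicular to [yi] but to no other [yj].
    [E_swap] holds for the pairs 1 and 2, for 1 and 3, and for 1 and the product of 2 and 3.
    Expanding the third identity and cancelling the other two leaves [w ^ b k * D = 1], where [w] is
    [1] or [D]. *)
Lemma alt_fixed : D ^ b k = D.
Proof.
have out (S : {group A}) : (#|S| < 16)%N -> exists h, h \notin S.
  move=> S16; apply/existsP; rewrite -negb_forall; apply: contraL S16 => /forallP R.
  rewrite -leqNgt -oA -cardsT subset_leq_card //.
  by apply/subsetP=> z _.
have card4 y : y != 1 -> y != r -> #|perp (b k) y| = 4.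
  by move=> yn yr; have [_ _ [_ _ o]] := tripleY yn yr.
have out4 y : y != 1 -> y != r -> exists h, h \notin perp (b k) y.
  by move=> y1 yr; apply: (out [group of perp (b k) y]); rewrite /= card4.
have s_ne y : y != 1 -> y != r -> s k y != 1 /\ s k y != r.
  have s1 : s k 1 = r by apply: shift1.
  have sr : s k r = 1 by rewrite -s1 shiftK.
  by move=> yn yr; split; [rewrite -sr | rewrite -s1]; rewrite (inj_eq (@sI k)).
(* [r] and [x] generate the group [perp (b k) y] of order 4, so a subgroup [T] containing both
   contains all of it. *)
have not5 (T : {group A}) x y z : y != 1 -> y != r -> x \in perp (b k) y ->
    z \in perp (b k) y -> x != 1 -> x != r -> r \in T -> x \in T -> z \in T.
  move=> y1 yr px pz x1 xr Tr Tx; apply/negPn/negP=> nTz.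
  have := @five_elements _ [group of perp (b k) y] T r x z (perp_r y) px pz r1 x1 xr Tr
    Tx nTz.
  by rewrite /= card4.
have [h0 nh0] : exists h, h \notin perp (b k) y0.
  by apply: (out [group of perp (b k) y0]); have [_ _ [_ _ /= ->]] := tD.
have [y1n y1r] := perp_ne nh0; set y1 := y0 in y1n y1r.
have [x1n x1r] := s_ne _ y1n y1r; set x1 := s k y1 in x1n x1r.
have x1y1 : x1 \in perp (b k) y1 by apply: sP.
pose T1 := [group of perp (b k) y1].
have T1r : r \in T1 by apply: perp_r.
have [x2 n21] := out4 _ y1n y1r; have [x2n x2r] := perp_neh n21.
have [y2n y2r] := s_ne _ x2n x2r; set y2 := s k x2 in y2n y2r.
have y2x2 : y2 \in perp (b k) x2 by apply: sP.
have x2y2 : x2 \in perp (b k) y2 by rewrite perp_symb.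
have n12 : x1 \notin perp (b k) y2.
  by apply: contra n21 => p; apply: (not5 T1 x1 y2 x2 y2n y2r p x2y2 x1n x1r T1r x1y1).
have [_ _ [[_ _ sz1 _] R1 o1]] := tripleY y1n y1r.
pose T2 := [group of perp (a y1 ^ b k) x2].
have T1T2 : T1 \subset T2 by rewrite /= -R1 rad_sub.
(* Lying outside [T2] means that [t x2 y1 x3] is true: this produces the factor [D] in the last
   expansion. *)
have [x3 n3] : exists h, h \notin T2.
  by apply: out; rewrite sz1 ?uV ?R1 // o1.
have T2r : r \in T2 by apply: (subsetP T1T2); apply: perp_r.
have T2x2 : x2 \in T2 by have := alt x2 y1; rewrite /t => /negbFE.
have n31 : x3 \notin perp (b k) y1 by apply: contra n3 => /(subsetP T1T2).
have [x3n x3r] := perp_neh n31.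
have [y3n y3r] := s_ne _ x3n x3r; set y3 := s k x3 in y3n y3r.
have y3x3 : y3 \in perp (b k) x3 by apply: sP.
have x3y3 : x3 \in perp (b k) y3 by rewrite perp_symb.
have n13 : x1 \notin perp (b k) y3.
  by apply: contra n31 => p; apply: (not5 T1 x1 y3 x3 y3n y3r p x3y3 x1n x1r T1r x1y1).
have n32 : x3 \notin perp (b k) y2.
  by apply: contra n3 => p; apply: (not5 T2 x2 y2 x3 y2n y2r x2y2 p x2n x2r T2r T2x2).
have n23 : x2 \notin perp (b k) y3.
  by apply: contra n3 => p; apply: (not5 T2 x2 y3 x3 y3n y3r p x3y3 x2n x2r T2r T2x2).
have P23 := perpM y2x2 y3x3 n32 n23.
have nT2 : x2 * x3 \notin T2 by rewrite groupMl.
have n231 : x2 * x3 \notin perp (b k) y1.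
  by apply: contra nT2 => /(subsetP T1T2).
have y23 c : c \in perp (b k) x3 -> y2 * y3 != c.
  move=> pc; apply: contra n32 => /eqP E23; rewrite perp_symb.
  by rewrite -(groupMr y2 (y3x3 : y3 \in [group of perp (b k) x3])) E23.
have y23n : y2 * y3 != 1 by apply: y23; apply: (group1 [group of perp (b k) x3]).
have y23r : y2 * y3 != r by apply: y23; apply: perp_r.
have x23 : x2 * x3 \in perp (b k) (y2 * y3) by rewrite perp_symb.
have n123 : x1 \notin perp (b k) (y2 * y3).
  by apply: contra n231 => p;
    apply: (not5 T1 x1 (y2 * y3) (x2 * x3) y23n y23r p x23 x1n x1r T1r x1y1).
have y1x1 : y1 \in perp (b k) x1 by rewrite perp_symb.
have E12 := E_swap y1x1 y2x2 n21 n12; have E13 := E_swap y1x1 y3x3 n31 n13.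
have := E_swap y1x1 P23 n231 n123.
have t3 : t x2 y1 x3 by apply: n3.
rewrite E_mulr E_mull t3; set w := eps (t y2 x1 y3).
have cw h y : commute (w ^ b k) (E h y) by apply: epsJE.
have cDE h y : commute D (E h y) := @cE h y true.
move=> /(cancel_pairs E12 E13 (cw _ _) (cw _ _) (cDE _ _)).
rewrite /w; case: (t y2 x1 y3) => /= [E1|]; last by rewrite conj1g mul1g => D0;
  case/eqP: D1.
by rewrite -[RHS](mulgg1_inv D2); apply/eqP;
  rewrite eq_sym eq_invg_mul (commute_sym _) ?E1 //; apply: (@eps_epsJ true true).
Qed.

End Alternating.

(** If some [t h y h] is true, then [EV] makes [D] equal to a commutator that [cvalJ] evaluates as
    [1] or [D ^ b k]. Otherwise the form is alternating. *)
Lemma triple_fixed : D ^ b k = D.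
Proof.
have [//|DJ] := eqVneq (D ^ b k) D.
apply: alt_fixed => h y; apply: contra_neqF DJ => th.
have E1 : [~ E h y, a y ^ b k] = D by rewrite EV cval th.
by move: E1; rewrite cvalJ; case: (t y h y) => //= E1; case/eqP: D1; rewrite -E1 conj1g.
Qed.

End Triple.

Lemma triple_cent_B k y D x : triple k y D -> commute D (b x).
Proof.
move=> tD.
pose S := (b @*^-1 'C[D])%G.
suff ST : S = [set: B] :> {set B}.
  by have : x \in (S : {set B}); [rewrite ST inE | move/mem_precent1].
apply: large_subgroup; first exact: card_B.
pose F h := k * f (y * s k h).
have FI : injective F by move=> h1 h2 /mulgI/(can_inj fK)/mulgI/sI.
suff : F @: (~: perp (b k) y) \subset S.
  by move/subset_leq_card; rewrite card_imset // (card_perpC tD); apply: leq_trans.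
apply/subsetP=> _ /imsetP[h + ->]; rewrite in_setC => nh; apply/mem_precent1/commute_conjg.
have tD2 := triple_mul tD nh (sP k h).
exact: triple_fixed (triple_mulf tD2).
Qed.

(** Rewriting [e] exhibits 8 elements of [csupp e]. Replacing [h] by [h * v], with [v] perpendicular
    to [y], allows [k * f (h * v)] in place of [k]; replacing [y] by [y * v], with [v] perpendicular
    to [h], allows conjugation by [b (f (y * v))], which fixes [a (y * v)]. *)
Lemma comm_cent_full :
  (forall k h y z, commute [~ a h ^ b k, a y] (a z)) ->
  forall k h y z x, commute [~ a h ^ b k, a y] (a z ^ b x).
Proof.
move=> full k h y z x; set e := [~ _, _].
have [/perpP/commgP/eqP hy|nhy] := boolP (y \in perp (b k) h).
  by rewrite /e hy; apply/commute_sym/commute1.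
apply: csupp_full; set r := g k.
have Rr : r \in rad (b k) := g_rad cAA gK abC k.
have rh h' : r \in perp (b k) h' by have /radP := Rr.
have k1 : k != 1.
  by apply: contraNneq nhy => ->; apply/perpP; rewrite morph1 conjg1; apply: aC1.
have h1 : h != 1.
  by apply: contraNneq nhy => ->; rewrite perp_symb (group1 [group of perp (b k) y]).
have hr : h != r by apply: contraNneq nhy => ->; rewrite perp_symb.
have oP := perp_size k1 h1 hr.
have cJ k' h' y' z' : commute [~ a h' ^ b k', a y'] (a z' ^ b k').
  apply/commute_sym/commuteJl; rewrite conjRg conjgK -invgR bV.
  by apply: commuteV; apply/commute_sym/full.
have eh v z' : v \in perp (b k) y -> commute e (a z' ^ b (k * f (h * v))).
  move=> py; rewrite /e -(comm_mull cAA h (u := b k) (v := v)) ?bV //.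
  by rewrite -(conj_mulf cBB abC); apply: cJ.
have ey v z' : v \in perp (b k) h -> commute e (a z' ^ b (f (y * v))).
  move=> ph; rewrite /e -(comm_mulr cAA _ ph).
  have /conjg_commute <- := abC (y * v).
  apply/commute_sym/commuteJl; rewrite conjRg conjgK -(conjgM (a h)) bV -(morphTM b).
  exact/commute_sym/full.
pose X1 := [set 1; k; k * f h; k * f (h * r)].
pose X2 := f @: (y *: perp (b k) h).
have sX : X1 :|: X2 \subset csupp e.
  rewrite subUset; apply/andP; split; apply/subsetP=> v.
    rewrite !in_setU !in_set1 -!orbA => /or4P[] /eqP-> ; apply/csuppP=> z'.
    - by rewrite morph1 conjg1; apply: full.
    - exact: cJ.
    - by have := eh 1 z'; rewrite mulg1; apply; apply: (group1 [group of perp (b k) y]).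
    - exact: eh.
  by case/imsetP=> _ /lcosetP[w Pw ->] ->; apply/csuppP=> z'; apply: ey.
apply: leq_trans (subset_leq_card sX).
have inX2 v : v \in X2 -> g v \notin perp (b k) h.
  case/imsetP=> _ /lcosetP[w Pw ->] ->; rewrite fK.
  by rewrite (groupMr y (Pw : w \in [group of perp (b k) h])).
(* [g] maps [X1] into [perp (b k) h] and [X2] onto a coset outside it. *)
have dis : [disjoint X1 & X2].
  rewrite disjoint_sym disjoints_subset; apply/subsetP=> v /inX2.
  rewrite in_setC; apply: contra; rewrite !in_setU !in_set1 -!orbA => /or4P[] /eqP->.
  - by rewrite (inv_fix1 fK f1) (group1 [group of perp (b k) h]).
  - exact: rh.
  - exact: sP.
  have := sP k (h * r); rewrite perp_symb => hr'; rewrite perp_symb.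
  by rewrite -(groupMr h (rh _ : r \in [group of perp (b k) (s k (h * r))])).
rewrite cardsU disjoint_setI0 // cards0 subn0.
rewrite card_imset; last exact: (can_inj fK).
rewrite card_lcoset; apply: (@leq_add 4 4) oP.
rewrite /X1 -!setUA !cardsU1 cards1 !in_setU !in_set1.
have kf v : (1 == k * f v) = (v == r).
  rewrite eq_sym -eq_invg_mul (exp2_inv B2) eq_sym /r.
  by apply/eqP/eqP=> [<-|->]; rewrite ?fK ?gK.
have kfk v : (k == k * f v) = (v == 1).
  rewrite -[X in X == _]mulg1 (inj_eq (mulgI k)) eq_sym.
  by rewrite -[X in _ == X]f1 (inj_eq (can_inj fK)).
have r1 : r != 1 by apply: (g_neq1 k1).
rewrite !kf !kfk (inj_eq (mulgI k)) (inj_eq (can_inj fK)) (eq_sym 1) (negPf k1) (negPf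
  hr) (negPf h1).
rewrite -eq_invg_mul (exp2_inv A2) (negPf hr) -[X in _ * _ == X]mul1g (inj_eq (mulIg
  r)) (negPf h1).
by rewrite -[X in X == _]mulg1 (inj_eq (mulgI h)) eq_sym (negPf r1).
Qed.

End TwoGroups.

Lemma coset_comp_morph (gT A : finGroupType) (a : {morphism [set: A] >-> gT}) (N :
  {group gT}) :
  N <| [set: gT] -> {in [set: A] &, {morph coset N \o a : x y / x * y}}.
Proof.
move=> nN x y _ _ /=; rewrite (morphTM a) morphM //; apply: (subsetP (normal_norm nN));
  exact: in_setT.
Qed.

Lemma commg_coset (gT : finGroupType) (N : {group gT}) (x y : gT) :
  N <| [set: gT] -> [~ coset N x, coset N y] = coset N [~ x, y].
Proof.
move=> nN; have nx z : z \in 'N(N) by apply: (subsetP (normal_norm nN)); apply: in_setT.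
by rewrite morphR.
Qed.

Lemma conjg_coset (gT : finGroupType) (N : {group gT}) (x y : gT) :
  N <| [set: gT] -> coset N x ^ coset N y = coset N (x ^ y).
Proof.
move=> nN; have nx z : z \in 'N(N) by apply: (subsetP (normal_norm nN)); apply: in_setT.
by rewrite morphJ.
Qed.

Lemma coset_eq1 (gT : finGroupType) (N : {group gT}) (x : gT) :
  N <| [set: gT] -> (coset N x == 1) = (x \in N).
Proof.
move=> nN; have nx z : z \in 'N(N) by apply: (subsetP (normal_norm nN)); apply: in_setT.
by apply/eqP/idP=> [/coset_idr|/coset_id]; [apply|].
Qed.

Section TwoGroupsCentral.
Variables (gT A B : finGroupType).
Variables (a : {morphism [set: A] >-> gT}) (b : {morphism [set: B] >-> gT}).
Variables (f : A -> B) (g : B -> A).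
Hypotheses (A2 : forall x : A, x * x = 1) (B2 : forall x : B, x * x = 1).
Hypothesis oA : #|A| = 16.
Hypotheses (fK : cancel f g) (gK : cancel g f) (f1 : f 1 = 1).
Hypothesis abC : forall h, commute (a h) (b (f h)).
Hypothesis ab_gen : forall S : {group gT},
  (forall h, a h \in S) -> (forall k, b k \in S) -> S = [set: gT] :> {set gT}.

(** Triple commutators of the form [y, h^k, z] are [1] or a [D] centralized by [A] and [B], hence
    central. So the hypothesis of [comm_cent_full] holds modulo the centre, where the lemma is
    applied. *)
Lemma triple_comm_center h k y z x :
  [~ [~ a h ^ b k, a y], a z ^ b x] \in 'Z([set: gT]).
Proof.
pose Z := 'Z([set: gT])%G; have nZ : 'Z([set: gT]) <| [set: gT] := center_normal _.
have cJ u v : coset 'Z([set: gT]) u ^ coset 'Z([set: gT]) v = coset 'Z([set: gT]) (u ^ v).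
  exact: conjg_coset.
pose a' := Morphism (coset_comp_morph a nZ); pose b' := Morphism (coset_comp_morph b nZ).
have full k' h' y' z' : commute [~ a' h' ^ b' k', a' y'] (a' z').
  apply/commgP; rewrite /= conjg_coset // !commg_coset // coset_eq1 //.
  set u := a h' ^ b k'; rewrite -(invgR (a y')); set c := [~ a y', u]; rewrite -/Z.
  have Zc : [~ c, a z'] \in Z.
    rewrite (comm_commg a (exp2_abelian A2)).
    have [/perpP/commgP/eqP->|nz] := boolP (z' \in perp a u y'); first exact: group1.
    have tD := tripleI A2 B2 oA fK gK f1 abC nz.
    apply/centerP; split=> [|w _]; first exact: in_setT.
    have : w \in (('C[ [~ a y' ^ u, a z'] ])%G : {set gT}); last by move/cent1P.
    rewrite ab_gen ?in_setT // => [v|v]; apply/cent1P/commute_sym.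
      by have [[_ _ cD _] _ _] := tD.
    exact: triple_cent_B tD.
  have := commMgJ c c^-1 (a z'); rewrite mulgV comm1g => /esym/eqP.
  rewrite -eq_invg_mul => /eqP <-; rewrite groupV memJ_norm //.
  by apply: (subsetP (normal_norm nZ)); apply: in_setT.
have abC' w : commute (a' w) (b' (f w)).
  by apply/commgP; rewrite /= commg_coset // coset_eq1 // (eqP (introT commgP (abC w))).
have /commgP := @comm_cent_full _ _ _ a' b' f g A2 B2 oA fK gK f1 abC' full k h y z x.
by rewrite /= !conjg_coset // !commg_coset // coset_eq1.
Qed.
End TwoGroupsCentral.

(** * Products of two normal subgroups of small class *)

Lemma commg_gen_sub (gT : finGroupType) (K : {group gT}) (S T : {set gT}) :
    S \subset 'N(K) -> T \subset 'N(K) ->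
    (forall s t, s \in S -> t \in T -> [~ s, t] \in K) ->
  [~: <<S>>, <<T>>] \subset K.
Proof.
move=> nS nT ST; rewrite -quotient_cents2 ?gen_subG // !quotient_gen //.
rewrite gen_subG /= cent_gen quotient_cents2 //.
by rewrite gen_subG; apply/subsetP=> _ /imset2P[s t Ss Tt ->]; apply: ST.
Qed.

Lemma lcn3_gen (gT : finGroupType) (S : {set gT}) :
  (forall s t w, s \in S -> t \in S -> w \in S -> [~ [~ s, t], w] = 1) ->
  'L_3(<<S>>) = 1.
Proof.
move=> S3; pose N := <<S>>%G; apply/commG1P.
have nZ : S \subset 'N('Z(N)) by apply: subset_trans (subset_gen S) (normal_norm
  (center_normal N)).
apply: subset_trans (subsetIr N 'C(N)); apply: commg_gen_sub => // s t Ss St.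
rewrite inE groupR ?mem_gen //=; rewrite cent_gen; apply/centP=> w Sw.
exact/commgP/eqP/S3.
Qed.

Section Fitting.
Variables (gT : finGroupType) (M N : {group gT}).
Hypotheses (nMN : M \subset 'N(N)) (nNM : N \subset 'N(M)).

Let inR x y : x \in M -> y \in N -> [~ x, y] \in M :&: N.
Proof.
move=> Mx Ny; have := mem_commg Mx Ny; apply: subsetP.
by apply: commg_subI; rewrite subsetI subxx.
Qed.

(** All commutators lie in the intersection of [M] and [N], which both groups centralize. *)
Lemma lcn2_abelian_join : abelian M -> abelian N -> 'L_3(M <*> N) = 1.
Proof.
move=> cM cN; pose I := (M :&: N)%G; pose G := (M <*> N)%G.
have nI : M :|: N \subset 'N(I).
  by rewrite subUset /= !normsI // ?normG.
have L2 : 'L_2(G) \subset I.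
  apply: commg_gen_sub => // x y /setUP[] Hx /setUP[] Hy.
  - by rewrite (eqP (introT commgP (centsP cM _ Hx _ Hy))) group1.
  - exact: inR.
  - by rewrite -invgR groupV inR.
  - by rewrite (eqP (introT commgP (centsP cN _ Hx _ Hy))) group1.
apply/trivgP; apply: subset_trans (commSg _ L2) _; rewrite /= -[M :&: N]genGid.
apply: (@commg_gen_sub _ 1%G) => /=; rewrite ?norm1 ?subsetT // => x y.
case/setIP=> Mx Nx /setUP[] Hy; apply/set1P/eqP/commgP.
  exact: (centsP cM).
exact: (centsP cN).
Qed.

Hypotheses (M3 : 'L_3(M) = 1) (N3 : 'L_3(N) = 1).

Let cM x y : x \in M^`(1) -> y \in M -> [~ x, y] = 1.
Proof.
by move=> Mx My; have : [~ x, y] \in 'L_3(M) := mem_commg Mx My; rewrite M3 => /set1P.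
Qed.
Let cN x y : x \in N^`(1) -> y \in N -> [~ x, y] = 1.
Proof.
by move=> Mx My; have : [~ x, y] \in 'L_3(N) := mem_commg Mx My; rewrite N3 => /set1P.
Qed.

Let G := (M <*> N)%G.
Let nMder : N \subset 'N(M^`(1)).  Proof. by apply: normsR. Qed.
Let nNder : M \subset 'N(N^`(1)).  Proof. by apply: normsR. Qed.
(** [K2], [K3], [K4] bound the terms 2, 3, 4 of the lower central series of [G]. The last one is
    central, because class 2 makes M' centralize [M] and N' centralize [N]. *)
Let S2 := M^`(1) :|: N^`(1) :|: (M :&: N).
Let K2 := <<S2>>%G.
Let K3 := ((M^`(1) :&: N) <*> (N^`(1) :&: M))%G.
Let K4 := (M^`(1) :&: N^`(1))%G.
Let nK2 : M :|: N \subset 'N(K2).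
Proof.
by rewrite subUset /= !norms_gen // !normsU ?normsI // ?normG ?normal_norm ?der_normal.
Qed.
Let nK3 : M :|: N \subset 'N(K3).
Proof.
by rewrite subUset /= !normsY ?normsI // ?normG ?normal_norm ?der_normal.
Qed.
Let nK4 : M :|: N \subset 'N(K4).
Proof.
by rewrite subUset /= !normsI // ?normG ?normal_norm ?der_normal.
Qed.

Let comm_sub (S : {set gT}) (K : {group gT}) :
    S \subset G -> M :|: N \subset 'N(K) ->
    (forall x y, x \in S -> y \in M -> [~ x, y] \in K) ->
    (forall x y, x \in S -> y \in N -> [~ x, y] \in K) -> [~: <<S>>, G] \subset K.
Proof.
move=> sS nK SM SN; apply: commg_gen_sub => //.
  by apply: subset_trans sS _; rewrite gen_subG.
by move=> x y Sx /setUP[]; [apply: SM | apply: SN].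
Qed.

Let sM : M \subset G. Proof. exact: joing_subl. Qed.
Let sN : N \subset G. Proof. exact: joing_subr. Qed.
Let inR2 x y : x \in N -> y \in M -> [~ x, y] \in M :&: N.
Proof. by move=> Nx My; rewrite -invgR groupV inR. Qed.
Let sM1 : M^`(1) \subset M := der_sub 1 M.
Let sN1 : N^`(1) \subset N := der_sub 1 N.
Let inRM x y : x \in M^`(1) -> y \in N -> [~ x, y] \in M^`(1).
Proof. by move=> Mx Ny;
  rewrite commgEl groupMl ?groupV // memJ_norm // (subsetP nMder). Qed.
Let inRN x y : x \in N^`(1) -> y \in M -> [~ x, y] \in N^`(1).
Proof. by move=> Mx Ny;
  rewrite commgEl groupMl ?groupV // memJ_norm // (subsetP nNder). Qed.

Lemma lcn2_join : 'L_2(G) \subset K2.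
Proof.
apply: comm_sub => //; first by rewrite subUset sM.
  move=> x y /setUP[] Hx Hy; apply: mem_gen; rewrite !in_setU.
    by rewrite [_ \in M^`(1)]mem_commg.
  by rewrite inR2 ?orbT.
move=> x y /setUP[] Hx Hy; apply: mem_gen; rewrite !in_setU; first by rewrite inR ?orbT.
by rewrite [_ \in N^`(1)]mem_commg ?orbT.
Qed.

Lemma lcn3_join : 'L_3(G) \subset K3.
Proof.
apply: subset_trans (commSg _ lcn2_join) _.
have K3l x : x \in M^`(1) -> x \in N -> x \in K3.
  by move=> Mx Nx; apply: (subsetP (joing_subl _ _)); rewrite inE Mx.
have K3r x : x \in N^`(1) -> x \in M -> x \in K3.
  by move=> Mx Nx; apply: (subsetP (joing_subr _ _)); rewrite inE Mx.
apply: comm_sub => //.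
- by rewrite !subUset (subset_trans sM1) // (subset_trans sN1) // subIset // sM.
- move=> x y /setUP[/setUP[]|/setIP[]] Hx Hy; first by rewrite cM // group1.
    by apply: K3r; [apply: inRN | have := inR2 (subsetP sN1 _ Hx) Hy; case/setIP].
  by move=> My; apply: K3l; [apply: mem_commg | have := inR2 Hy My; case/setIP].
- move=> x y /setUP[/setUP[]|/setIP[]] Hx Hy.
  + by apply: K3l; [apply: inRM | have := inR (subsetP sM1 _ Hx) Hy; case/setIP].
  + by rewrite cN // group1.
  + by move=> Ny; apply: K3r; [apply: mem_commg | have := inR Hx Ny; case/setIP].
Qed.

Lemma lcn4_join : 'L_4(G) \subset K4.
Proof.
apply: subset_trans (commSg _ lcn3_join) _.
apply: comm_sub => //.
- by rewrite subUset !subIset // ?sM // ?sN ?orbT.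
- move=> x y /setUP[/setIP[]|/setIP[]] Hx Hy Hz; first by rewrite cM // group1.
  by rewrite inE inRN // mem_commg.
- move=> x y /setUP[/setIP[]|/setIP[]] Hx Hy Hz; last by rewrite cN // group1.
  by rewrite inE inRM // mem_commg.
Qed.

Let cK4 : [~: K4, G] = 1.
Proof.
apply/trivgP; rewrite -[gval K4]genGid; apply: comm_sub; rewrite ?norm1 ?subsetT //.
- by rewrite subIset // (subset_trans sM1) ?sM.
- by move=> x y /setIP[Mx _] My; rewrite cM // group1.
- by move=> x y /setIP[_ Nx] Ny; rewrite cN // group1.
Qed.

Lemma lcn5_join : 'L_5(G) = 1.
Proof. by apply/trivgP; rewrite -cK4; apply: commSg lcn4_join. Qed.

(** Among the generators of [K2], only M' against N' and two elements of the intersection of [M] and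
    [N] can fail to commute, and in both cases the commutator lies in the central [K4]. *)
Lemma der2_join_central : [~: G^`(2), G] = 1.
Proof.
apply/trivgP; rewrite -cK4; apply: commSg.
apply: subset_trans (commgSS lcn2_join lcn2_join) _.
have nS2 : S2 \subset 'N(K4).
  apply: subset_trans nK4; rewrite !subUset subIset ?subsetUl // andbT.
  by rewrite (subset_trans sM1) ?subsetUl // (subset_trans sN1) ?subsetUr.
have MN x y : x \in M^`(1) -> y \in N^`(1) -> [~ x, y] \in K4.
  move=> Mx Ny; rewrite inE inRM ?(subsetP sN1) // -invgR groupV.
  by rewrite inRN ?(subsetP sM1).
have c1 x y : [~ x, y] = 1 -> [~ x, y] \in K4 /\ [~ y, x] \in K4.
  by move=> xy1; rewrite -[[~ y, x]]invgR xy1 invg1 group1.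
apply: commg_gen_sub => // x y.
case/setUP=> [/setUP[] Hx|/setIP[Mx Nx]] /setUP[/setUP[] Hy|/setIP[My Ny]].
- by case: (c1 x y) => //; rewrite cM ?(subsetP sM1).
- exact: MN.
- by case: (c1 x y) => //; rewrite cM.
- by rewrite -invgR groupV MN.
- by case: (c1 x y) => //; rewrite cN ?(subsetP sN1).
- by case: (c1 x y) => //; rewrite cN.
- by case: (c1 y x) => //; rewrite cM.
- by case: (c1 y x) => //; rewrite cN.
- by rewrite inE !mem_commg.
Qed.

End Fitting.

(** For the derived length: [G'', G, G] = 1, so the three subgroup lemma gives [G', G''] = 1, a
    group that contains G'''. *)
Lemma class5_of_quotient (gT : finGroupType) (G : {group gT}) :
    'L_5(G / 'Z(G)) = 1 -> [~: (G / 'Z(G))^`(2), G / 'Z(G)] = 1 ->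
  [/\ nilpotent G, (nil_class G <= 5)%N & G^`(3) = 1].
Proof.
move=> L5 D2; have nZ : G \subset 'N('Z(G)) := normal_norm (center_normal G).
have cZ : [~: 'Z(G), G] = 1 by apply/commG1P; apply: subsetIr.
have L6 : 'L_6(G) = 1.
  apply/trivgP; rewrite -cZ; apply: commSg; rewrite -quotient_sub1.
    by have -> : 'L_5(G) / 'Z(G) = 'L_5(G / 'Z(G)) := morphim_lcn _ 5 nZ; rewrite L5.
  exact: subset_trans (lcn_sub 5 G) nZ.
have nilG : nilpotent G by apply/lcnP; exists 5.
split=> //; first exact/lcn_nil_classP.
have D2G : [~: G^`(2), G] \subset 'Z(G).
  rewrite -quotient_sub1; last first.
    by apply: subset_trans nZ; apply: subset_trans (commSg _ (der_sub 2 G)) (der_sub 1 G).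
  have -> : [~: G^`(2), G] / 'Z(G) = [~: G^`(2) / 'Z(G), G / 'Z(G)].
    by apply: morphimR; rewrite ?(subset_trans (der_sub _ _)).
  by rewrite quotient_der // D2.
have D2GG : [~: G^`(2), G, G] = 1 by apply/trivgP; rewrite -cZ commSg.
have GDG : [~: G, G^`(2), G] = 1 by rewrite [[~: G, _]]commGC.
have GGD := three_subgroup GDG D2GG.
apply/trivgP; rewrite -GGD; apply: commSg.
exact: commgSS (der_sub 1 G) (der_sub 1 G).
Qed.

(** * Normal closures of the two factors *)

Section JointGeneration.
Variables (gT A B : finGroupType).
Variables (a : {morphism [set: A] >-> gT}) (b : {morphism [set: B] >-> gT}).

Definition jointly_gen := forall S : {group gT},
  (forall h, a h \in S) -> (forall k, b k \in S) -> S = [set: gT] :> {set gT}.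

(** Conjugates under [B] suffice: the group contains the image of [A] and is normalized by that of
    [B], so it is normal once the two generate. *)
Definition nclosure := <<[set a hx.1 ^ b hx.2 | hx : A * B]>>.
Canonical nclosure_group := [group of nclosure].

Lemma mem_nclosureJ h x : a h ^ b x \in nclosure.
Proof. by apply: mem_gen; apply/imsetP; exists (h, x). Qed.

Lemma mem_nclosure h : a h \in nclosure.
Proof. by rewrite -[a h]conjg1 -(morph1 b) mem_nclosureJ. Qed.

Hypothesis ab_gen : jointly_gen.

Lemma nclosure_norm : [set: gT] \subset 'N(nclosure).
Proof.
rewrite -(ab_gen (S := 'N(nclosure)%G)) // => [h|k].
  by apply: (subsetP (normG _)); apply: mem_nclosure.
rewrite inE sub_conjg gen_subG; apply/subsetP=> _ /imsetP[[h x] _ ->] /=.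
by rewrite mem_conjg invgK -conjgM -(morphTM b) mem_nclosureJ.
Qed.

End JointGeneration.

Lemma jointly_genC (gT A B : finGroupType)
    (a : {morphism [set: A] >-> gT}) (b : {morphism [set: B] >-> gT}) :
  jointly_gen a b -> jointly_gen b a.
Proof. by move=> ab S bS aS; apply: ab. Qed.

Lemma nclosure_join (gT A B : finGroupType)
    (a : {morphism [set: A] >-> gT}) (b : {morphism [set: B] >-> gT}) :
  jointly_gen a b -> nclosure a b <*> nclosure b a = [set: gT].
Proof.
move=> ab; apply: (ab (nclosure a b <*> nclosure b a)%G) => [h|k] /=.
  by apply: (subsetP (joing_subl _ _)); apply: mem_nclosure.
by apply: (subsetP (joing_subr _ _)); apply: mem_nclosure.
Qed.

Lemma lcn3_nclosure (gT A B : finGroupType)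
    (a : {morphism [set: A] >-> gT}) (b : {morphism [set: B] >-> gT}) :
    (forall h k y z x, [~ [~ a h ^ b k, a y], a z ^ b x] = 1) ->
  'L_3(nclosure a b) = 1.
Proof.
move=> abT; apply: lcn3_gen => _ _ _ /imsetP[[h k] _ ->] /imsetP[[y l] _ ->] /imsetP[[z
  x] _ ->] /=.
rewrite -[a h ^ _](conjgKV (b l)) -conjRg -[a z ^ _](conjgKV (b l)) -conjRg.
by rewrite -!conjgM -(morphTV b) -!(morphTM b) abT conj1g.
Qed.

Lemma jointly_gen_coset (gT A B : finGroupType)
    (a : {morphism [set: A] >-> gT}) (b : {morphism [set: B] >-> gT}) (N : {group gT})
    (a' : {morphism [set: A] >-> coset_of N}) (b' : {morphism [set: B] >-> coset_of N}) :
    N <| [set: gT] -> (forall h, a' h = coset N (a h)) -> (forall k, b' k = coset N (b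
      k)) ->
  jointly_gen a b -> jointly_gen a' b'.
Proof.
move=> nN Ea Eb ab S aS bS; apply/setP=> u; rewrite in_setT.
have nx z : z \in 'N(N) by apply: (subsetP (normal_norm nN)); apply: in_setT.
have ST : coset N @*^-1 S = [set: gT].
  apply: (ab (coset N @*^-1 S)%G) => h; rewrite /= mem_morphpre ?nx //.
    by have := aS h; rewrite Ea.
  by have := bS h; rewrite Eb.
have [x _ ->] := cosetP u; have : x \in coset N @*^-1 S by rewrite ST in_setT.
by case/morphpreP.
Qed.

Section TwoGroupsClass.
Variables (gT A B : finGroupType).
Variables (a : {morphism [set: A] >-> gT}) (b : {morphism [set: B] >-> gT}).
Variables (f : A -> B) (g : B -> A).
Hypotheses (A2 : forall x : A, x * x = 1) (B2 : forall x : B, x * x = 1).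
Hypothesis oA : #|A| = 16.
Hypotheses (fK : cancel f g) (gK : cancel g f) (f1 : f 1 = 1).
Hypothesis abC : forall h, commute (a h) (b (f h)).
Hypothesis ab_gen : jointly_gen a b.

Lemma class5_two_groups :
  [/\ nilpotent [set: gT], (nil_class [set: gT] <= 5)%N & [set: gT]^`(3) = 1].
Proof.
have gen1 : g 1 = 1 by rewrite -f1 fK.
have baC w : commute (b w) (a (g w)) by have := abC (g w); rewrite gK.
pose Z := 'Z([set: gT])%G; have nZ : Z <| [set: gT] := center_normal _.
pose a' := Morphism (coset_comp_morph a nZ); pose b' := Morphism (coset_comp_morph b nZ).
have ab' : jointly_gen a' b' by apply: jointly_gen_coset ab_gen.
have a3 : 'L_3(nclosure a' b') = 1.
  apply: lcn3_nclosure => h k y z x; apply/eqP.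
  rewrite /= !conjg_coset // !commg_coset // coset_eq1 //.
  exact: (triple_comm_center A2 B2 oA fK gK f1 abC ab_gen).
have b3 : 'L_3(nclosure b' a') = 1.
  apply: lcn3_nclosure => h k y z x; apply/eqP.
  rewrite /= !conjg_coset // !commg_coset // coset_eq1 //.
  apply: (triple_comm_center B2 A2 (card_B oA fK gK) gK fK gen1 baC); exact: jointly_genC.
have nM : nclosure a' b' \subset 'N(nclosure b' a').
  by apply: subset_trans (subsetT _) (nclosure_norm (jointly_genC ab')).
have nN : nclosure b' a' \subset 'N(nclosure a' b').
  by apply: subset_trans (subsetT _) (nclosure_norm ab').
have ET : [set: gT] / Z = nclosure a' b' <*> nclosure b' a'.
  rewrite nclosure_join //; apply/setP=> u; rewrite in_setT.
  by have [x nx ->] := cosetP u; rewrite mem_quotient ?in_setT.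
apply: class5_of_quotient.
  by rewrite [_ / _]ET lcn5_join.
by rewrite [_ / _]ET der2_join_central.
Qed.

End TwoGroupsClass.

Lemma fst_comp_morph (gT A C : finGroupType) (a : {morphism [set: A] >-> gT}) :
  {in [set: A * C] &, {morph a \o fst : x y / x * y}}.
Proof. by move=> x y _ _ /=; rewrite -(morphTM a). Qed.

Lemma class5_two_groups_le (gT A B : finGroupType)
    (a : {morphism [set: A] >-> gT}) (b : {morphism [set: B] >-> gT})
    (f : A -> B) (g : B -> A) :
    (forall x : A, x * x = 1) -> (forall x : B, x * x = 1) ->
    #|A| = 8 \/ #|A| = 16 -> cancel f g -> cancel g f -> f 1 = 1 ->
    (forall h, commute (a h) (b (f h))) -> jointly_gen a b ->
  [/\ nilpotent [set: gT], (nil_class [set: gT] <= 5)%N & [set: gT]^`(3) = 1].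
Proof.
move=> A2 B2 [oA|oA] fK gK f1 abC ab; last first.
  exact: class5_two_groups A2 B2 oA fK gK f1 abC ab.
(* The added factor of order 2 is killed by [a'] and [b'], while [f'] is the identity on it; the
   relations and joint generation are unaffected. *)
pose a' := Morphism (@fst_comp_morph _ _ 'I_2 a).
pose b' := Morphism (@fst_comp_morph _ _ 'I_2 b).
have sq2 (C : finGroupType) (C2 : forall x : C, x * x = 1) (x : C * 'I_2) : x * x = 1.
  by case: x => x [[|[|[]]] // i]; congr (_, _); rewrite ?C2 //; apply: val_inj.
pose f' (x : A * 'I_2) := (f x.1, x.2); pose g' (x : B * 'I_2) := (g x.1, x.2).
apply: (@class5_two_groups _ _ _ a' b' f' g') => //.
- exact: sq2.
- exact: sq2.
- by rewrite card_prod oA card_ord.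
- by case=> x c; rewrite /g' /f' /= fK.
- by case=> x c; rewrite /g' /f' /= gK.
- by rewrite /f' /= f1.
- by case=> x c; apply: abC.
move=> S aS bS; apply: ab => [h|k]; first exact: (aS (h, 1)).
exact: (bS (k, 1)).
Qed.

(** * Groups of order 27 and exponent 3 *)

(** A group of order 3 has only two automorphisms, and the one induced by [u] has order dividing
    3. *)
Lemma commute_order3 (gT : finGroupType) (x u : gT) :
  x ^+ 3 = 1 -> x != 1 -> u ^+ 3 = 1 -> x ^ u \in <[x]> -> commute x u.
Proof.
move=> x3 x1 u3 /cycleP[i Ei]; apply: commute_conjg.
have : (i %% 3 < 3)%N by rewrite ltn_mod.
rewrite -(expg_mod i x3) in Ei.
case: (i %% 3) Ei => [|[|[|//]]] Ei _ //.
  by case/eqP: x1; apply: (conjg_inj u); rewrite conj1g.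
have xuu : x ^ (u * u) = x.
  by rewrite conjgM Ei conjXg Ei -expgM expgS x3 mulg1.
by rewrite -{1}xuu -conjgM -mulgA -[u * (u * u)]/(u ^+ 3) u3 conjg1.
Qed.

Lemma card_subgroup27 (C : finGroupType) (S : {group C}) :
  #|C| = 27 -> #|S| \in [:: 1; 3; 9; 27]%N.
Proof.
move=> oC; have := cardSg (subsetT S); rewrite cardsT oC.
by rewrite dvdn_divisors.
Qed.

Section ThreeGroups.
Variables (gT A B : finGroupType).
Variables (a : {morphism [set: A] >-> gT}) (b : {morphism [set: B] >-> gT}).
Variables (f : A -> B) (g : B -> A).
Hypotheses (cAA : abelian [set: A]) (cBB : abelian [set: B]).
Hypotheses (A3 : forall x : A, x ^+ 3 = 1) (B3 : forall x : B, x ^+ 3 = 1).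
Hypothesis oA : #|A| = 27.
Hypotheses (fK : cancel f g) (gK : cancel g f) (f1 : f 1 = 1).
Hypothesis abC : forall h, commute (a h) (b (f h)).
Local Notation perp := (perp a).
Local Notation rad := (rad a).
Implicit Types (h y z : A) (k x : B).
Local Notation s := (shift f g).
Let sP k h : s k h \in perp (b k) h := shift_perp cAA cBB gK abC k h.
Let sI k : injective (s k) := shift_inj fK gK (k := k).
Let bV k : (b k)^-1 = b k^-1. Proof. by rewrite morphTV. Qed.
Let gk1 k : k != 1 -> g k != 1. Proof. exact: g_neq1 gK f1 k. Qed.

Definition conj_comm k h y := [~ a h ^ b k, a y].
Local Notation e := conj_comm.

Lemma conj_comm_neq1 k h y : (e k h y != 1) = (y \notin perp (b k) h).
Proof. by rewrite perpN. Qed.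

Lemma g_radV k : g k \in rad (b k^-1).
Proof.
rewrite -bV; apply/radVP=> y; apply/perpP; rewrite (conj_g gK abC).
exact: commute_morph.
Qed.

Lemma conj_comm_mulf k h y : e (k * f h) h y = e k h y.
Proof. by rewrite /conj_comm (conj_mulf cBB abC). Qed.

Lemma conj_commV k h y : e k h y ^ b k^-1 = (e k^-1 y h)^-1.
Proof. by rewrite /conj_comm conjRg -conjgM -morphTM mulgV morph1 conjg1 invgR. Qed.

Lemma conj_comm_neqV k h y : e k h y != 1 -> e k^-1 y h != 1.
Proof. by rewrite -(conjg_eq1 _ (b k^-1)) conj_commV eq_invg1. Qed.

Lemma card_gt1_witness (S : {group A}) v : v \in S -> v != 1 -> (1 < #|S|)%N.
Proof. by move=> Sv v1; rewrite cardG_gt1; apply/trivgPn; exists v. Qed.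

(** Were the order 9, the radical would equal [perp (b k) h'] for all [h'] outside the left radical,
    and [s k] would inject these at least 18 elements into it. *)
Lemma card_rad3 k h y : e k h y != 1 -> #|rad (b k)| = 3.
Proof.
move=> nf; have k1 : k != 1.
  apply: contraNneq nf => ->; rewrite /conj_comm morph1 conjg1; apply/commgP;
    exact: commute_morph.
have Rr : g k \in rad (b k) := g_rad cAA gK abC k.
have R1 : (1 < #|rad (b k)|)%N := @card_gt1_witness [group of rad (b k)] _ Rr (gk1 k1).
have nfR : y \notin rad (b k) by rewrite conj_comm_neq1 in nf; apply: contra nf => /radP.
have nfL : h \notin rad (b k^-1) by rewrite conj_comm_neq1 in nf; apply: contra nf;
  rewrite -bV => /radVP.
have ltT (S : {group A}) v : v \notin S -> (#|S| < 27)%N.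
  move=> nv; rewrite -oA -cardsT; apply: proper_card; rewrite properT.
  by apply: contra nv => /eqP->; rewrite in_setT.
have R27 := ltT [group of rad (b k)] _ nfR; have L27 := ltT [group of rad (b k^-1)] _ nfL.
have := card_subgroup27 [group of rad (b k)] oA;
  have := card_subgroup27 [group of rad (b k^-1)] oA.
rewrite !inE /= => oL oR.
have [//|oR9] : #|rad (b k)| = 3 \/ #|rad (b k)| = 9.
  by move: R1 R27; case/or4P: oR => /eqP->; auto.
have L9 : (#|rad (b k^-1)| <= 9)%N by move: L27; case/or4P: oL => /eqP->.
have : s k @: (~: rad (b k^-1)) \subset rad (b k).
  apply/subsetP=> _ /imsetP[h' + ->]; rewrite in_setC => nh.
  suff -> : rad (b k) = perp (b k) h' by apply: sP.
  apply/eqP; rewrite eqEcard rad_sub oR9 /=.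
  have [z nz] : exists z, z \notin perp (b k) h'.
    apply/existsP; rewrite -negb_forall; apply: contra nh => /forallP P.
    by rewrite -bV; apply/radVP.
  have := ltT [group of perp (b k) h'] z nz;
    have := card_subgroup27 [group of perp (b k) h'] oA.
  by rewrite !inE /=; case/or4P=> /eqP->.
move/subset_leq_card; rewrite card_imset; last exact: sI.
by rewrite oR9 cardsCs setCK oA; move: L9; lia.
Qed.

(** Were [perp (b k) h] just the radical, [s k] would map the coset of [h] modulo the left radical
    onto it. As [g k = s k 1] is in the radical, [1] would be in that coset. *)
Lemma card_perp9 k h y : e k h y != 1 -> #|perp (b k) h| = 9.
Proof.
move=> nf; have oR := card_rad3 nf; have oL := card_rad3 (conj_comm_neqV nf).
have nfL : h \notin rad (b k^-1) by rewrite conj_comm_neq1 in nf; apply: contra nf;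
  rewrite -bV => /radVP.
have sR := rad_sub a (b k) h.
have P27 : (#|perp (b k) h| < 27)%N.
  rewrite -oA -cardsT; apply: proper_card; rewrite properT; rewrite conj_comm_neq1 in nf.
  by apply: contra nf => /eqP->; rewrite in_setT.
have P3 : (3 < #|perp (b k) h|)%N.
  rewrite ltnNge -oR; apply: contra nfL => P3.
  have /eqP E : rad (b k) == perp (b k) h by rewrite eqEcard sR.
  have sF : s k @: (h *: rad (b k^-1)) \subset rad (b k).
    apply/subsetP=> _ /imsetP[_ /lcosetP[v Lv ->] ->].
    suff -> : rad (b k) = perp (b k) (h * v) by apply: sP.
    rewrite E; apply/setP=> z; rewrite !(perp_sym a (b k)).
    rewrite (groupMr h (_ : v \in [group of perp (b k)^-1 z])) //.
    by rewrite bV; have /radP := Lv; apply.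
  have /eqP F : s k @: (h *: rad (b k^-1)) == rad (b k).
    by rewrite eqEcard sF card_imset // card_lcoset oL oR.
  have : g k \in s k @: (h *: rad (b k^-1)) by rewrite F (g_rad cAA gK abC).
  case/imsetP=> _ /lcosetP[v Lv ->]; rewrite -(shift1 g f1) => /sI E1.
  by rewrite -(groupMr h (Lv : v \in [group of rad (b k^-1)])) -E1 (group1 [group of
    rad (b k^-1)]).
have := card_subgroup27 [group of perp (b k) h] oA; rewrite !inE /=.
by case/or4P=> /eqP E; rewrite E in P27 P3 *.
Qed.

Lemma nf_nondeg k h y : e k h y != 1 -> nondeg a 3 (b k).
Proof.
move=> nf; have nfV := conj_comm_neqV nf.
split; rewrite ?bV ?cardsT ?(card_rad3 nf) ?(card_rad3 nfV) //.
  move=> h' nh; have [z nz] : exists z, z \notin perp (b k) h'.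
    apply/existsP; rewrite -negb_forall; apply: contra nh => /forallP P.
    by rewrite -bV; apply/radVP.
  by apply: (@card_perp9 _ _ z); rewrite conj_comm_neq1.
move=> y' ny; have [z nz] : exists z, z \notin perp (b k^-1) y'.
  apply/existsP; rewrite -negb_forall; apply: contra ny => /forallP P.
  by apply/radP=> v; rewrite perp_sym bV.
by apply: (@card_perp9 _ _ z); rewrite conj_comm_neq1.
Qed.

Lemma radE_three k h y : e k h y != 1 -> rad (b k^-1) = [set 1; g k; g k^-1].
Proof.
move=> nf; apply/esym/eqP; rewrite eqEcard (card_rad3 (conj_comm_neqV nf)); apply/andP;
  split.
  apply/subsetP=> v; rewrite !in_setU !in_set1 -orbA => /or3P[] /eqP->.
  - exact: (group1 [group of rad (b k^-1)]).
  - exact: g_radV.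
  - exact: (g_rad cAA gK abC).
have k1 : k != 1.
  apply: contraNneq nf => ->; rewrite /conj_comm morph1 conjg1; apply/commgP;
    exact: commute_morph.
have kV1 : k^-1 != 1 by rewrite eq_invg1.
rewrite -setUA cardsU1 cards2 !inE (eq_sym 1) (negPf (gk1 k1)) (eq_sym 1) (negPf (gk1 kV1)).
rewrite (inj_eq (can_inj gK)) (_ : k != k^-1) //.
apply: contra k1 => /eqP kk; have := B3 k.
have kk1 : k * k = 1 by rewrite {1}kk mulVg.
by rewrite expgS expgS expg1 kk1 mulg1 => ->.
Qed.

Section Nontrivial.
Variables (k0 : B) (h0 y0 : A).
Hypothesis nf0 : e k0 h0 y0 != 1.
Let D := e k0 h0 y0.

Definition comm_span k := (exists h y, e k h y != 1) /\ (forall h y, e k h y \in <[D]>).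

Lemma comm_span0 : comm_span k0.
Proof.
split; first by exists h0, y0.
move=> h y; have [->|nf] := eqVneq (e k0 h y) 1; first exact: group1.
by apply: (nondeg_cycle cAA (isT : prime 3) (nf_nondeg nf0)); rewrite -conj_comm_neq1.
Qed.

(** The element [h] solves [k * f h = k'], so [e k] and [e k'] agree on it; the three excluded [k']
    are those for which [h] falls into the left radical. *)
Lemma comm_span_step k k' : comm_span k -> k' \notin [set 1; k; k^-1] -> comm_span k'.
Proof.
case=> [[h1 [y1 nf]] eD] nk'; pose h := g (k^-1 * k').
have nh : h \notin rad (b k^-1).
  rewrite (radE_three nf); apply: contra nk'; rewrite !in_setU !in_set1 -!orbA.
  case/or3P=> [/eqP h1'|/eqP/(can_inj gK) E|/eqP/(can_inj gK) E].
  - have /eqP : f h = 1 by rewrite h1'.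
    by rewrite /h gK -eq_mulVg1 => /eqP->; rewrite eqxx orbT.
  - have := B3 k; rewrite (canRL (mulKVg k) E) /= expgS expgS expg1 => /eqP.
    by rewrite -eq_invg_mul eq_sym => ->; rewrite !orbT.
  - by rewrite (canRL (mulKVg k) E) /= mulgV eqxx.
have E y : e k' h y = e k h y by rewrite -(conj_comm_mulf k h y) /h gK mulKVg.
have [y ny] : exists y, y \notin perp (b k) h.
  apply/existsP; rewrite -negb_forall; apply: contra nh => /forallP P.
  by rewrite -bV; apply/radVP.
have nf' : e k' h y != 1 by rewrite E conj_comm_neq1.
split; first by exists h, y.
move=> h2 y2; have [->|nf2] := eqVneq (e k' h2 y2) 1; first exact: group1.
have : e k' h2 y2 \in <[e k' h y]>.
  by apply: (nondeg_cycle cAA (isT : prime 3) (nf_nondeg nf')); rewrite -conj_comm_neq1.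
by apply: subsetP; rewrite cycle_subG E.
Qed.

Lemma all_comm_span k : k != 1 -> comm_span k.
Proof.
move=> k1; have [k0k|] := boolP (k \in [set 1; k0; k0^-1]);
  last exact: comm_span_step comm_span0.
have k01 : k0 != 1.
  apply: contraNneq nf0 => ->; rewrite /conj_comm morph1 conjg1; apply/commgP;
    exact: commute_morph.
have [x nx] : exists x, x \notin [set 1; k0; k0^-1].
  apply/existsP; rewrite -negb_forall; apply/forallP=> P.
  have : (#|B| <= #|[set 1%g; k0; k0^-1]|)%N.
    by rewrite -cardsT; apply/subset_leq_card/subsetP=> v _; apply: P.
  have -> : #|B| = 27 by rewrite -oA; apply/esym/bij_eq_card; exists g.
  by rewrite -setUA; apply/negP; rewrite -ltnNge;
    apply: leq_ltn_trans (leq_card_setU _ _) _; rewrite cards1 cards2; case: (_ == _).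
apply: comm_span_step (comm_span_step comm_span0 nx) _.
move: nx k0k; rewrite !in_setU !in_set1 (negPf k1) /= !negb_or -!andbA.
case/and3P=> x1 xk xkV; case/orP=> /eqP->.
  by rewrite eq_sym xk -eqg_invLR eq_sym xkV.
by rewrite eq_sym xkV eqg_inv eq_sym xk.
Qed.

End Nontrivial.

Lemma conj_comm_cent_a k h y z : commute (e k h y) (a z).
Proof.
have [->|nf] := eqVneq (e k h y) 1; first exact/commute_sym/commute1.
have nd := nf_nondeg nf.
exact: (nondeg_comm_cent cAA (isT : prime 3) _ _ _ nd).
Qed.

Lemma conj_comm_exp3 k h y : e k h y ^+ 3 = 1.
Proof.
have : e k h (y ^+ 3) = 1 by rewrite /conj_comm A3 morph1 commg1.
rewrite /conj_comm 2!expgS expg1 !(morphTM a) commgMJ commgMJ -/(e k h y).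
have c z : e k h y ^ a z = e k h y := conjg_commute (conj_comm_cent_a k h y z).
by rewrite conjgM !c !expgS expg0 mulg1 -(mulgA (e k h y)).
Qed.

(** Conjugation by [b x^-1] sends a value [D'] of [e x] to the inverse of a value of [e x^-1]. All
    values lie in one group of order 3, which is thus normalized, and [commute_order3] applies. *)
Lemma conj_comm_cent_b k h y x : commute (e k h y) (b x).
Proof.
have [->|nf] := eqVneq (e k h y) 1; first exact/commute_sym/commute1.
set D := e k h y in nf *.
have [->|x1] := eqVneq x 1; first by rewrite morph1; apply: commute1.
have gd x' : x' != 1 -> comm_span k h y x' by apply: all_comm_span.
have [[h1 [y1 n1]] inD] := gd x x1.
have [_ inDV] : comm_span k h y x^-1 by apply: gd; rewrite invg_eq1.
set D' := e x h1 y1 in n1.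
have o3 k1 h' y' : e k1 h' y' != 1 -> #[e k1 h' y'] = 3.
  by move=> n; apply: nt_prime_order => //; apply: conj_comm_exp3.
have EC : <[D']> = <[D]>.
  by apply/eqP; rewrite eqEcard cycle_subG inD -!orderE !o3.
have cD' : commute D' (b x^-1).
  apply: commute_order3 => //; first exact: conj_comm_exp3.
    by rewrite -(morphX b) ?in_setT // B3 morph1.
  by rewrite EC conj_commV groupV.
have /cycleP[i ->] : D \in <[D']> by rewrite EC cycle_id.
apply/commute_sym/commuteX; have := commuteV (y := b x^-1) cD'.
by rewrite (morphTV b) invgK => /commute_sym.
Qed.

Definition cent_ab w := (forall z, commute w (a z)) /\ (forall x, commute w (b x)).

Lemma conj_comm_central k h y : cent_ab (e k h y).
Proof. by split; [apply: conj_comm_cent_a | apply: conj_comm_cent_b]. Qed.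

Lemma cent_conj_comm w k h y : cent_ab w -> commute w (e k h y).
Proof. by case=> ca cb; apply: commute_comm => //; apply: commute_conj2. Qed.

Lemma conj_comm_mull k h h' y : e k (h * h') y = e k h y * e k h' y.
Proof.
have [ca cb] := conj_comm_central k h y.
by rewrite /conj_comm morphTM conjMg commMgJ conjg_commute //; apply: commute_conj2.
Qed.

Lemma conj_comm_mulr k h y y' : e k h (y * y') = e k h y * e k h y'.
Proof.
rewrite (cent_conj_comm k h y' (conj_comm_central k h y)).
by rewrite /conj_comm morphTM commgMJ [X in _ * X]conjg_commute //; apply: conj_comm_cent_a.
Qed.

End ThreeGroups.

Lemma sum_two_values (T : finType) (K : {set T}) (F : T -> nat) c d :
    (forall k, k \in K -> F k = c) -> (forall k, k \notin K -> F k = d) ->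
  (\sum_k F k = #|K| * c + #|~: K| * d)%N.
Proof.
move=> Fc Fd; rewrite (bigID (mem K)) /= (eq_bigr _ Fc) (eq_bigr _ Fd).
by rewrite !sum_nat_const; congr (_ + _ * _)%N; apply: eq_card => k; rewrite !inE.
Qed.

(* Otherwise [R] would pair off the 13 subgroups of order 3. *)
Lemma self_related (A : finGroupType) (R : A -> {group A}) :
    (forall x : A, x ^+ 3 = 1) -> #|A| = 27 ->
    (forall h y, (y \in R h) = (h \in R y)) ->
    (forall h, h != 1 -> #|R h| = 3) ->
  exists2 h, h != 1 & h \in R h.
Proof.
move=> A3 oA Rsym R3; apply/exists_inP; apply: contraT => /exists_inPn noR.
(* Without a self-related element, [F h] has 4 elements, and these sets partition the 26 nonidentity
   elements; 4 does not divide 26. *)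
pose F h : {set A} := (R h :|: <[h]>) :\ 1.
have o3 (h : A) : h != 1 -> #|<[h]>| = 3.
  by move=> h1; rewrite -orderE; apply: (nt_prime_order (isT : prime 3)).
have R_eq (h : A) (S : {group A}) : h != 1 -> #|S| = 3 -> h \in S -> <[h]> = S.
  by move=> h1 oS Sh; apply/eqP; rewrite eqEcard cycle_subG Sh /= oS o3.
have FE (h h' : A) : h != 1 -> h' \in F h -> F h' = F h.
  move=> h1 /setD1P[h'1 /setUP[Rh'|hh']].
    rewrite /F (R_eq h' (R h)) ?R3 // setUC; congr ((_ :|: _) :\ 1).
    by apply/esym/R_eq; rewrite ?R3 // Rsym.
  rewrite /F (R_eq h' <[h]>%G) ?o3 //; congr ((_ :|: _) :\ 1).
  apply/esym/eqP; rewrite eqEcard !R3 // leqnn andbT; apply/subsetP=> y.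
  by rewrite Rsym [y \in _]Rsym -!cycle_subG; apply: subset_trans; rewrite cycle_subG.
have oF (h : A) : h != 1 -> #|F h| = 4.
  move=> h1; have : #|R h :|: <[h]>| = 5.
    rewrite cardsU R3 // o3 //; suff -> : R h :&: <[h]> = 1 by rewrite cards1.
    apply/trivgP/subsetP=> v /setIP[Rv hv]; rewrite inE; apply: contraT => v1.
    case/negP: (noR _ h1); rewrite -cycle_subG -(R_eq v <[h]>%G) ?o3 //.
    by rewrite cycle_subG.
  by rewrite (cardsD1 1) in_setU group1 => - [].
have : #|[set~ (1 : A)]| = 26 by rewrite cardsC1 oA.
have -> : #|[set~ (1 : A)]| = (\sum_(X in F @: [set~ 1%g]) 4)%N.
  rewrite -sum1_card (partition_big_imset F) /=; apply: eq_bigr => _ /imsetP[h + ->].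
  rewrite !inE => h1; rewrite -(oF h h1) -sum1_card; apply: eq_bigl => h'.
  rewrite in_setC in_set1; apply/andP/idP=> [[h'1 /eqP<-]|Fh'].
    by rewrite !inE h'1 cycle_id orbT.
  by rewrite (FE h) //; case/setD1P: Fh'.
by rewrite sum_nat_const; move: #|_| => m; lia.
Qed.

Section ThreeGroupsTrivial.
Variables (gT A B : finGroupType).
Variables (a : {morphism [set: A] >-> gT}) (b : {morphism [set: B] >-> gT}).
Variables (f : A -> B) (g : B -> A).
Hypotheses (cAA : abelian [set: A]) (cBB : abelian [set: B]).
Hypotheses (A3 : forall x : A, x ^+ 3 = 1) (B3 : forall x : B, x ^+ 3 = 1).
Hypothesis oA : #|A| = 27.
Hypotheses (fK : cancel f g) (gK : cancel g f) (f1 : f 1 = 1).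
Hypothesis abC : forall h, commute (a h) (b (f h)).
Local Notation perp := (perp a).
Local Notation rad := (rad a).
Local Notation e := (conj_comm a b).
Implicit Types (h y z : A) (k x : B).

Let baC k : commute (b k) (a (g k)). Proof. by have := abC (g k); rewrite gK. Qed.
Let oB : #|B| = 27. Proof. by rewrite -oA; apply/esym/bij_eq_card; exists g. Qed.

Let eC k h y : cent_ab a b (e k h y). Proof. exact: (conj_comm_central cAA cBB A3 B3 oA
  fK gK f1 abC). Qed.
Let eCb h k l : cent_ab b a (conj_comm b a h k l).
Proof. exact: (conj_comm_central cBB cAA B3 A3 oB gK fK (inv_fix1 fK f1) baC). Qed.

(* With [c = [h, k]], [h^(k l) = h^l (h^-1 h^k) [c, l]] and [[c, l]] is central, by
   centrality of the commutators [[k^h, l]]. *)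
Lemma conj_comm_mulk k l h y : e (k * l) h y = e k h y * e l h y.
Proof.
pose c := [~ b k, a h]; have [cb ca] := eCb h k l; set w := conj_comm b a h k l in ca cb.
have Ew : [~ c, b l] = w by apply: comm_commg.
have cl : c ^ b l = c * w by rewrite -Ew commgEl mulKVg.
have hk l' : a h ^ b l' = a h * [~ b l', a h]^-1 by rewrite invgR commgEl mulKVg.
have cwh v : commute w (a v ^ b l) by apply: commute_conj2.
have E : a h ^ b (k * l) = a h ^ b l * w^-1 * (a h)^-1 * a h ^ b k.
  by rewrite morphTM conjgM (hk k) -/c conjMg conjVg cl invMg !mulgA mulgKV.
have [ea eb] := eC l h y.
have c1 (u v : gT) (c2 : commute u v) : [~ u, v] = 1 := eqP (introT commgP c2).
rewrite {1}/conj_comm E 3!commMgJ (c1 w^-1); last by apply/commute_sym/commuteV/commute_sym.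
rewrite (c1 (a h)^-1); last by rewrite -(morphTV a); apply: commute_morph.
rewrite !mulg1 -/(e k h y) -/(e l h y).
have we : commute (e l h y) w by apply/commute_sym/cent_conj_comm; split.
rewrite (conjg_commute (commuteV we)) -(morphTV a) (conjg_commute (ea _)).
rewrite conjg_commute; last exact: commute_conj2.
exact/cent_conj_comm/eC.
Qed.

(** Linearity makes [e k^-1] the inverse of [e k], while conjugation by [b k^-1], trivial on these
    values, exchanges the two arguments along with an inversion. *)
Lemma conj_comm_sym k h y : e k h y = e k y h.
Proof.
have E1 : e k h y * e k^-1 h y = 1.
  by rewrite -conj_comm_mulk mulgV /conj_comm morph1 conjg1; apply/eqP/commgP/commute_morph.
have := conj_commV a b k y h; rewrite (conjg_commute (proj2 (eC _ _ _) _)) => ->.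
by apply/eqP; rewrite eq_sym eq_invg_mul -(cent_conj_comm _ _ _ (eC _ _ _)) E1.
Qed.

Let conj_comm_mull := conj_comm_mull cAA cBB A3 B3 oA fK gK f1 abC.
Let conj_comm_mulr := conj_comm_mulr cAA cBB A3 B3 oA fK gK f1 abC.
Let conj_comm_exp3 := conj_comm_exp3 cAA cBB A3 oA fK gK f1 abC.

Section Nontrivial.
Variables (k1 : B) (h1 y1 : A).
Hypothesis nf1 : e k1 h1 y1 != 1.
Let D := e k1 h1 y1.

Let gd k : k != 1 -> comm_span a b k1 h1 y1 k.
Proof. exact: (all_comm_span cAA cBB B3 oA fK gK f1 abC nf1). Qed.

Let in_perp k h y : (y \in perp (b k) h) = (e k h y == 1).
Proof. by rewrite -[LHS]negbK -conj_comm_neq1 negbK. Qed.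

Let e1 h y : e 1 h y = 1.
Proof. by rewrite /conj_comm morph1 conjg1; apply/eqP/commgP/commute_morph. Qed.

Let eD k h y : e k h y \in <[D]>.
Proof.
have [->|k1'] := eqVneq k 1; first by rewrite e1 group1.
by have [_] := gd k1'.
Qed.

Let oD : #|<[D]>| = 3.
Proof. by rewrite -orderE; apply: (nt_prime_order (isT : prime 3)) => //;
  apply: conj_comm_exp3. Qed.

Let radEk k : k != 1 -> rad (b k) = [set 1; g k; g k^-1].
Proof.
move=> kn1; have kV1 : k^-1 != 1 by rewrite invg_eq1.
have [[h [y nf]] _] := gd kV1.
by rewrite -{1}[k]invgK (radE_three cAA cBB B3 oA fK gK f1 abC nf) invgK setUAC.
Qed.

Let in_rad k h : k != 1 -> h != 1 -> (h \in rad (b k)) = (k \in [set 1; f h; (f h)^-1]).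
Proof.
move=> kn1 hn1; rewrite radEk // !in_setU !in_set1 (negPf kn1) (negPf hn1) /=.
rewrite -eqg_invLR -(inj_eq (can_inj fK)) gK -[X in _ || X](inj_eq (can_inj fK)) gK.
by rewrite eq_sym [X in _ || X]eq_sym.
Qed.

Let radE1 k h : k != 1 -> reflect (forall y, e k h y = 1) (h \in rad (b k)).
Proof.
move=> kn1; apply: (iffP (radP _ _ _)) => H y.
  by rewrite conj_comm_sym; apply/eqP; rewrite -in_perp.
by rewrite in_perp conj_comm_sym H.
Qed.

Let Rh h := (\bigcap_k perp (b k) h)%G.

Let RhP h y : reflect (forall k, e k h y = 1) (y \in Rh h).
Proof.
apply: (iffP bigcapP) => [H k|H k _]; last by rewrite in_perp H.
by apply/eqP; rewrite -in_perp H.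
Qed.

Let Rh_sym h y : (y \in Rh h) = (h \in Rh y).
Proof. by apply/RhP/RhP => H k; rewrite conj_comm_sym. Qed.

Lemma conj_comm_morph h y : {in [set: B] &, {morph (fun k => e k h y) : k l / k * l}}.
Proof. by move=> k l _ _; apply: conj_comm_mulk. Qed.

(** Double count the pairs [(k, y)] with [e k h y = 1]. Each [k] in [K] admits 27 elements [y], any
    other [k] admits 9; each [y] in [Rh h] admits 27 elements [k], any other [y] admits 9. With [r]
    the order sought, 3 * 27 + 24 * 9 = 27 * r + 9 * (27 - r). *)
Let Rh3 h : h != 1 -> #|Rh h| = 3.
Proof.
move=> hn1; have fn1 : f h != 1 by rewrite -f1 (inj_eq (can_inj fK)).
pose K := [set 1; f h; (f h)^-1].
have fV : f h != (f h)^-1.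
  apply: contra fn1 => /eqP E; have ff : f h * f h = 1 by rewrite {1}E mulVg.
  by have := B3 (f h); rewrite !expgS expg0 mulg1 ff mulg1 => ->.
have oK : #|K| = 3.
  by rewrite /K -setUA cardsU1 cards2 !inE eq_sym (negPf fn1) eq_sym invg_eq1 (negPf
    fn1) fV.
have S1 k : k \in K -> #|perp (b k) h| = 27.
  move=> Kk; rewrite -oA -cardsT; apply: eq_card => y; rewrite in_setT in_perp.
  have [->|kn1] := eqVneq k 1; first by rewrite e1 eqxx.
  by apply/eqP; apply/radE1; rewrite ?in_rad.
have S2 k : k \notin K -> #|perp (b k) h| = 9.
  move=> nK; have kn1 : k != 1 by apply: contraNneq nK => ->; rewrite !inE eqxx.
  have [y ny] : exists y, e k h y != 1.
    apply/existsP; rewrite -negb_forall; apply: contra nK => /forallP H.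
    by rewrite -in_rad //; apply/radE1 => // y; apply/eqP.
  exact: (card_perp9 cAA cBB oA fK gK f1 abC ny).
have T1 y : y \in Rh h -> #|[set k | e k h y == 1]| = 27.
  move=> /RhP H; rewrite -oB -cardsT; apply: eq_card => k.
  by rewrite in_setT inE H eqxx.
have T2 y : y \notin Rh h -> #|[set k | e k h y == 1]| = 9.
  move=> ny; pose phi := Morphism (@conj_comm_morph h y).
  have sC : phi @* [set: B] \subset <[D]>.
    by apply/subsetP=> _ /morphimP[k _ _ ->]; apply: eD.
  have : #|phi @* [set: B]| = 3.
    have := cardSg sC; rewrite oD; apply/prime_nt_dvdP => //.
    rewrite -trivg_card1; apply: contra ny => E; apply/RhP=> k.
    have : phi k \in phi @* [set: B] by rewrite mem_morphim ?in_setT.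
    by rewrite (eqP (idP E)) => /set1P.
  have -> : [set k | e k h y == 1] = 'ker phi.
    by apply/setP=> k; rewrite inE (sameP (kerP phi (in_setT k)) eqP).
  have := Lagrange (subsetT ('ker phi)%G); rewrite cardsT oB card_morphim setIid /=.
  by move=> L I; rewrite I in L; apply/eqP; rewrite -(@eqn_pmul2r 3) // [X in X == _]L.
have := sum_two_values S1 S2.
have -> : (\sum_k #|perp (b k) h| = \sum_y #|[set k | e k h y == 1%g]|)%N.
  under eq_bigr => k _ do rewrite -sum1_card big_mkcond /=.
  rewrite exchange_big /=; apply: eq_bigr => y _.
  rewrite -big_mkcond /= -sum1_card; apply: eq_bigl => k.
  by rewrite in_perp inE.
have oC (C : finType) (S : {set C}) : #|~: S| = (#|C| - #|S|)%N by rewrite cardsCs setCK.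
rewrite (sum_two_values T1 T2) !oC oK oB oA.
move: #|Rh h| (subset_leq_card (subsetT (Rh h))) => r; rewrite cardsT oA; lia.
Qed.

(* If [h0] lies in its own radical then [conj_comm (f h0)] is alternating; it is also
   symmetric, hence trivial. *)
Lemma conj_comm_contradiction : False.
Proof.
have [h0 h01 Rh0] := self_related A3 oA Rh_sym Rh3.
set k0 := f h0; have k01 : k0 != 1 by rewrite -f1 (inj_eq (can_inj fK)).
have gk0 : g k0 = h0 by apply: fK.
have k0V : k0^-1 = k0 * k0.
  by apply/eqP; rewrite eq_invg_mul -(B3 k0) !expgS expg0 mulg1.
suff alt w : e k0 w w = 1.
  have [[h [y]] /eqP[]] := gd k01.
  have := alt (h * y); rewrite conj_comm_mull !conj_comm_mulr !alt mul1g mulg1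
    (conj_comm_sym k0 y h).
  move=> ee; have := conj_comm_exp3 k0 h y.
  by rewrite !expgS expg0 mulg1 ee mulg1.
have [/(radE1 _ k01)//|nw] := boolP (w \in rad (b k0)).
pose k := f w; have gk : g k = w by apply: fK.
have nk : k \notin [set 1; k0; k0^-1].
  apply: contra nw; rewrite radEk // !in_setU !in_set1 -gk.
  by case/orP=> [/orP[]|] /eqP->; rewrite ?(inv_fix1 fK f1) ?eqxx ?orbT.
move: (nk); rewrite !in_setU !in_set1 !negb_or -andbA => /and3P[kn1 kk0 kk0V].
have kk01 : k * k0 != 1 by rewrite -eq_invg_mul eqg_invLR.
have radk v : e k w v = 1 by apply: (radE1 _ kn1); rewrite radEk // -gk !inE eqxx orbT.
have radkk0 v : e (k * k0) (g (k * k0)) v = 1.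
  by apply: (radE1 _ kk01); rewrite radEk // !inE eqxx orbT.
have ek v : e (k * k0) h0 v = e k h0 v by apply: (conj_comm_mulf cBB abC).
pose W := [group of perp (b k) h0]; pose S := [group of perp (b (k * k0)) w].
have oW : #|W| = 9.
  have [y ny] : exists y, e k h0 y != 1.
    apply/existsP; rewrite -negb_forall; apply: contra nk => /forallP H.
    by rewrite -in_rad //; apply/radE1 => // y; apply/eqP.
  exact: (card_perp9 cAA cBB oA fK gK f1 abC ny).
(* [W] contains [w], [h0] and [g (k * k0)], and [S] contains the last two. If [w] were outside [S],
   the intersection would be the group [<[h0]>] of order 3, inside [rad (b k0)]; but [g (k * k0)] is
   not there by the choice of [k]. *)
have Sw : w \in S.
  apply: contraT => nSw; pose T := (S :&: W)%G.
  have Th0 : h0 \in T.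
    rewrite in_setI /= !in_perp (conj_comm_sym _ w) ek (conj_comm_sym _ h0 w) radk eqxx.
    by apply/eqP; move/RhP: Rh0.
  have Tv : g (k * k0) \in T.
    by rewrite in_setI /= !in_perp (conj_comm_sym _ w) radkk0 -ek conj_comm_sym radkk0 eqxx.
  have oT : #|T| = 3.
    have : (#|T| < 9)%N.
      rewrite -oW; apply/proper_card/properP; split; first exact: subsetIr.
      exists w; last by rewrite in_setI (negPf nSw).
      by rewrite /= in_perp conj_comm_sym radk.
    have : (1 < #|T|)%N by rewrite cardG_gt1; apply/trivgPn; exists h0.
    by have := card_subgroup27 T oA; rewrite !inE; case/or4P=> /eqP->.
  have T_rad : T \subset rad (b k0).
    have hT : T \subset <[h0]>.
      have /eqP -> : <[h0]> == T; last exact: subxx.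
      rewrite eqEcard cycle_subG Th0 oT -orderE.
      by rewrite (nt_prime_order (isT : prime 3)).
    apply: subset_trans hT _.
    by rewrite cycle_subG /= radEk // !in_setU !in_set1 gk0 eqxx orbT.
  have := subsetP T_rad _ Tv; rewrite radEk // !in_setU !in_set1.
  rewrite -[X in _ == X](inv_fix1 fK f1) !(inj_eq (can_inj gK)) (negPf kk01) /=.
  case/orP=> /eqP E.
    by case/eqP: kn1; apply: (mulIg k0); rewrite E mul1g.
  by case/eqP: kk0; apply: (mulIg k0); rewrite E k0V.
have := conj_comm_mulk k k0 w w; rewrite radk mul1g => <-.
by apply/eqP; rewrite -in_perp.
Qed.

End Nontrivial.

Lemma commute_conj_three (h y : A) (k : B) : commute (a h ^ b k) (a y).
Proof.
apply/commgP; apply: contraT => nf.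
by case: (conj_comm_contradiction nf).
Qed.

Lemma abelian_nclosure_three : abelian (nclosure a b).
Proof.
rewrite /abelian /nclosure gen_subG /= cent_gen;
  apply/centsP=> _ /imsetP[[h k] _ ->] _ /imsetP[[y l] _ ->] /=.
apply/commute_sym/commuteJl; rewrite -conjgM -(morphTV b) -(morphTM b).
exact/commute_sym/commute_conj_three.
Qed.

Lemma comm_cent_three (h y : A) (k : B) : commute [~ a h, b k] (a y).
Proof.
have -> : [~ a h, b k] = (a h)^-1 * a h ^ b k by [].
apply/commute_sym/commuteM; last exact/commute_sym/commute_conj_three.
by apply/commuteV/commute_morph.
Qed.

End ThreeGroupsTrivial.

(** * Order of the group when all commutators of [A] with [B] are central *)

Section CentralCommutators.
Variables (gT A B : finGroupType).
Variables (a : {morphism [set: A] >-> gT}) (b : {morphism [set: B] >-> gT}).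
Variables (f : A -> B) (g : B -> A).
Hypotheses (oA : #|A| = 27) (oB : #|B| = 27).
Hypotheses (fK : cancel f g) (f1 : f 1 = 1).
Hypothesis abC : forall h, commute (a h) (b (f h)).
Hypothesis ab_gen : jointly_gen a b.
Let c h k := [~ a h, b k].
Local Notation Z := 'Z([set: gT]).
Hypothesis cZ : forall h k, c h k \in Z.
Implicit Types (h y : A) (k l : B) (T : {group gT}).

Let Zc w x : w \in Z -> commute w x.
Proof. by move/centerP=> [_ /(_ x)]; apply; rewrite in_setT. Qed.

Let c_mull h h' k : c (h * h') k = c h k * c h' k.
Proof. by rewrite /c morphTM commMgJ (conjg_commute (Zc _ (cZ _ _))). Qed.

Let c_mulr h k l : c h (k * l) = c h k * c h l.
Proof.
by rewrite /c morphTM commgMJ (conjg_commute (Zc _ (cZ _ _))) (Zc _ (cZ _ _)).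
Qed.

Let c_morph h : {in [set: B] &, {morph c h : k l / k * l}}.
Proof. by move=> k l _ _; apply: c_mulr. Qed.
Let phi h := Morphism (c_morph h).

Let kset T h := (phi h @*^-1 T)%G.

Let in_kset T h k : (k \in kset T h) = (c h k \in T).
Proof. by apply/morphpreP/idP=> [[]|] // cT; split; rewrite ?in_setT. Qed.

Let hset T := [set h | [forall k, c h k \in T]].
Let hsetP T h : reflect (forall k, c h k \in T) (h \in hset T).
Proof. by rewrite inE; apply: forallP. Qed.

Let hset_group T : group_set (hset T).
Proof.
apply/group_setP; split; first by apply/hsetP=> k; rewrite /c morph1 comm1g.
by move=> h h' /hsetP H /hsetP H'; apply/hsetP=> k; rewrite c_mull groupM.
Qed.
Let hgrp T := Group (hset_group T).

(** For [x] in [hset T], [c (h * x) (f (h * x)) = 1] puts [f (h * x)] into [kset T h]; the identity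
    is one element more. *)
Let kset_large T h : h \notin hset T -> (#|hset T| < #|kset T h|)%N.
Proof.
move=> nh; pose F := (fun x => f (h * x)) @: hset T.
have <- : #|F| = #|hset T|.
  by apply: card_imset => x y /(can_inj fK)/mulgI.
have F1 : 1 \notin F.
  apply: contra nh => /imsetP[x Hx]; rewrite -f1 => /(can_inj fK)/esym/eqP.
  by rewrite -eq_invg_mul -(groupV (hgrp T)) => /eqP->.
have <- : #|1 |: F| = #|F|.+1 by rewrite cardsU1 F1.
apply/subset_leq_card/subsetP=> _ /setU1P[->|/imsetP[x /hsetP Hx ->]]; first exact: group1.
rewrite in_kset -(groupMr _ (Hx (f (h * x)))) -c_mull /c.
by rewrite (eqP (introT commgP (abC _))) group1.
Qed.

Let extend T h : T \subset Z -> exists T' : {group gT},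
  [/\ T' \subset Z, T \subset T', h \in hset T' & (#|T'| * #|kset T h| = #|T| * 27)%N].
Proof.
move=> TZ; pose P := (phi h @* [set: B])%G.
have PZ : P \subset Z by apply/subsetP=> _ /morphimP[k _ _ ->]; apply: cZ.
have cPT : P \subset 'C(T).
  by apply/centsP=> x /(subsetP PZ) Px y _; apply: Zc.
exists (T <*> P)%G; split=> /=.
- by rewrite join_subG TZ.
- exact: joing_subl.
- apply/hsetP=> k; apply: (subsetP (joing_subr _ _)).
  by apply: (mem_morphim (phi h)); rewrite in_setT.
rewrite cent_joinEr //.
have oK : #|kset T h| = (#|'ker (phi h)| * #|T :&: P|)%N.
  rewrite -card_morphpre ?subsetIr //; apply: eq_card => k.
  rewrite in_kset; apply/idP/morphpreP=> [ck|[_ /setIP[]]] //.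
  split; rewrite ?in_setT //; apply/setIP; split=> //.
  by apply: (mem_morphim (phi h)); rewrite in_setT.
have oP : (#|'ker (phi h)| * #|P| = 27)%N.
  by rewrite card_morphim setIid -oB -cardsT Lagrange ?subsetT.
by rewrite oK mulnCA -mul_cardG -oP mulnCA.
Qed.

Let hset_full T : hset T = [set: A] -> forall h k, c h k \in T.
Proof. by move=> E h; apply/hsetP; rewrite E in_setT. Qed.

Let notin_hset T : hset T != [set: A] -> exists h, h \notin hset T.
Proof. by rewrite -subTset => /subsetPn[h _ nh]; exists h. Qed.

Let hsetS T T' : T \subset T' -> hset T \subset hset T'.
Proof. by move=> sT; apply/subsetP=> h /hsetP H; apply/hsetP=> k; apply: (subsetP sT). Qed.

Let hset_proper T T' h : T \subset T' -> h \in hset T' -> h \notin hset T ->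
  (#|hset T| < #|hset T'|)%N.
Proof. by move=> sT hT' hT; apply/proper_card/properP; split;
  [apply: hsetS | exists h]. Qed.

Let ord27_gt (C : finGroupType) (S : {group C}) : #|C| = 27 ->
  [/\ (1 < #|S| -> 3 <= #|S|)%N, (3 < #|S| -> 9 <= #|S|)%N & (9 < #|S| -> 27 <= #|S|)%N].
Proof. by move=> oC; have := card_subgroup27 S oC; rewrite !inE; case/or4P=> /eqP->. Qed.

(** Each adjunction enlarges [hset], and by [kset_large] this limits the next one: the successive
    indices are at most 9, 3 and 1. *)
Lemma commutators_card :
  exists T, [/\ T \subset Z, forall h k, c h k \in T & (#|T| <= 27)%N].
Proof.
have full T : T \subset Z -> (#|T| <= 27)%N -> hset T = [set: A] ->
    exists T, [/\ T \subset Z, forall h k, c h k \in T & (#|T| <= 27)%N].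
  by move=> TZ oT E; exists T; split=> //; apply: hset_full.
have [E|/notin_hset[h0 n0]] := eqVneq (hset 1%G) [set: A].
  by apply: full E; rewrite ?sub1G ?cards1.
have [T1 [Z1 s1 h1 o1]] := extend h0 (sub1G _).
have H0 := cardG_gt0 (hgrp 1%G).
have [k3 _ _] := ord27_gt (kset 1 h0) oB.
have {}k3 := k3 (leq_ltn_trans H0 (kset_large n0)).
have [h3 _ _] := ord27_gt (hgrp T1) oA.
have {}h3 := h3 (leq_ltn_trans H0 (hset_proper s1 h1 n0)).
rewrite cards1 in o1; have T9 : (#|T1| <= 9)%N by move: o1 k3; nia.
have [E|/notin_hset[h2 n2]] := eqVneq (hset T1) [set: A].
  by apply: full E => //; apply: leq_trans T9 _.
have [T2 [Z2 s2 h2' o2]] := extend h2 Z1.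
have [_ k9 _] := ord27_gt (kset T1 h2) oB.
have {}k9 := k9 (leq_ltn_trans h3 (kset_large n2)).
have [_ h9 _] := ord27_gt (hgrp T2) oA.
have {}h9 := h9 (leq_ltn_trans h3 (hset_proper s2 h2' n2)).
have T27 : (#|T2| <= 27)%N by move: o2 k9 T9; nia.
apply: (full T2) => //; apply/eqP/negPn/negP => /notin_hset[h4 n4].
have [_ _ k27] := ord27_gt (kset T2 h4) oB.
have {}k27 := k27 (leq_ltn_trans h9 (kset_large n4)).
case/negP: n4; apply/hsetP=> k; rewrite -in_kset.
suff -> : kset T2 h4 = [set: B] :> {set B} by rewrite in_setT.
by apply/eqP; rewrite eqEcard subsetT cardsT oB.
Qed.

(** The group is the product of [T] and the images of [A] and [B], each of order at most 27. *)
Lemma card_central_commutators : (#|gT| <= 3 ^ 9)%N.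
Proof.
have [T [TZ cT oT]] := commutators_card.
have cTx (x y : gT) : x \in T -> commute x y by move=> Tx; apply: Zc; apply: (subsetP TZ).
pose AA := (a @* [set: A])%G; pose BB := (b @* [set: B])%G.
have cTA : AA \subset 'C(T).
  by apply/centsP=> x _ y Ty; apply/commute_sym/cTx.
have nB : BB \subset 'N(T <*> AA).
  apply/subsetP=> _ /morphimP[k _ _ ->]; rewrite inE sub_conjg gen_subG.
  apply/subsetP=> x /setUP[Tx|/morphimP[h _ _ ->]]; rewrite mem_conjg invgK.
    by rewrite (conjg_commute (cTx _ _ Tx)) (subsetP (joing_subl _ _)).
  rewrite -[a h ^ b k](mulKVg (a h)) -commgEl groupM //.
    by apply: (subsetP (joing_subr _ _)); rewrite mem_morphim ?in_setT.
  by apply: (subsetP (joing_subl _ _)); apply: cT.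
have genT : (T <*> AA) * BB = [set: gT].
  rewrite -norm_joinEr //; apply: (ab_gen (S := (T <*> AA <*> BB)%G)) => [h|k] /=.
    apply: (subsetP (joing_subl _ _)); apply: (subsetP (joing_subr _ _)).
    by rewrite mem_morphim ?in_setT.
  by apply: (subsetP (joing_subr _ _)); rewrite mem_morphim ?in_setT.
have leM (G H : {group gT}) : (#|(G * H)%g| <= #|G| * #|H|)%N.
  by rewrite mul_cardG leq_pmulr ?cardG_gt0.
have oAA : (#|AA| <= 27)%N by rewrite -oA -cardsT leq_morphim.
have oBB : (#|BB| <= 27)%N by rewrite -oB -cardsT leq_morphim.
rewrite -cardsT -genT; apply: leq_trans (leM _ _) _; rewrite /= cent_joinEr //.
have := leM T AA; move: oAA oBB oT.
move: #|_| #|_| #|_| #|_| => m1 m2 m3 m4; nia.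
Qed.
End CentralCommutators.

Lemma class2_three_groups (gT A B : finGroupType)
    (a : {morphism [set: A] >-> gT}) (b : {morphism [set: B] >-> gT})
    (f : A -> B) (g : B -> A) :
    abelian [set: A] -> abelian [set: B] ->
    (forall x : A, x ^+ 3 = 1) -> (forall x : B, x ^+ 3 = 1) ->
    #|A| = 27 -> cancel f g -> cancel g f -> f 1 = 1 ->
    (forall h, commute (a h) (b (f h))) -> jointly_gen a b ->
  [/\ nilpotent [set: gT], (nil_class [set: gT] <= 2)%N & (#|gT| <= 3 ^ 9)%N].
Proof.
move=> cAA cBB A3 B3 oA fK gK f1 abC ab.
have oB : #|B| = 27 by rewrite -oA; apply/esym/bij_eq_card; exists g.
have baC w : commute (b w) (a (g w)) by have := abC (g w); rewrite gK.
have gen1 : g 1 = 1 by rewrite -f1 fK.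
have L3 : 'L_3([set: gT]) = 1.
  rewrite -(nclosure_join ab); apply: lcn2_abelian_join.
  - by apply: subset_trans (subsetT _) (nclosure_norm (jointly_genC ab)).
  - by apply: subset_trans (subsetT _) (nclosure_norm ab).
  - exact: (abelian_nclosure_three cAA cBB A3 B3 oA fK gK f1 abC).
  - exact: (abelian_nclosure_three cBB cAA B3 A3 oB gK fK gen1 baC).
have nilG : nilpotent [set: gT] by apply/lcnP; exists 2.
split=> //; first exact/lcn_nil_classP.
apply: (card_central_commutators oA oB fK f1 abC ab) => h k.
apply/centerP; split=> [|w _]; first exact: in_setT.
have : w \in ('C[ [~ a h, b k] ])%G; last by move/cent1P.
rewrite ab ?in_setT // => v; apply/cent1P/commute_sym.
  exact: (comm_cent_three cAA cBB A3 B3 oA fK gK f1 abC).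
rewrite -invgR; apply/commute_sym/commuteV/commute_sym.
exact: (comm_cent_three cBB cAA B3 A3 oB gK fK gen1 baC).
Qed.

(** * Finiteness and order *)

Section Alternating.
Variables (W : groupType) (A B : finGroupType).
Variables (a : A -> W) (b : B -> W) (f : A -> B) (g : B -> A).
Hypotheses (aM : {morph a : x y / x * y}) (bM : {morph b : x y / x * y}).
Hypotheses (fK : cancel f g) (gK : cancel g f) (f1 : f 1 = 1).
Hypothesis abC : forall h, commute (a h) (b (f h)).

(** Letters of both kinds are indexed by [A], so that the defining relation says: letters of
    adjacent positions with the same index commute. *)
Definition alt_letter m h := if odd m then b (f h) else a h.

(** These are the products of [m.+1] letters; identity letters are allowed, so the lists grow with
    [m]. *)
Fixpoint alt_words m : seq W :=
  if m is m'.+1 then [seq v * alt_letter m h | v <- alt_words m', h <- enum A]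
  else [seq alt_letter 0 h | h <- enum A].

Definition last_letters m u := [set s | u * (alt_letter m.+1 s)^-1 \in alt_words m].

Let a1 : a 1 = 1. Proof. by apply: (mulgI (a 1)); rewrite -aM !mulg1. Qed.
Let b1 : b 1 = 1. Proof. by apply: (mulgI (b 1)); rewrite -bM !mulg1. Qed.

Lemma letter1 m : alt_letter m 1 = 1. Proof. by rewrite /alt_letter f1 a1 b1 if_same. Qed.

Let letterSS m h : alt_letter m.+2 h = alt_letter m h.
Proof. by rewrite /alt_letter /= negbK. Qed.

Let letterC m h : commute (alt_letter m h) (alt_letter m.+1 h).
Proof. by rewrite /alt_letter /=; case: (odd m) => /=; [apply/commute_sym | ]. Qed.

Definition ldiv m s x := if odd m then g ((f s)^-1 * f x) else s^-1 * x.

Let letter_ldiv m s x : alt_letter m (ldiv m s x) = (alt_letter m s)^-1 * alt_letter m x.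
Proof.
rewrite /alt_letter /ldiv; case: (odd m); rewrite ?gK.
  by apply: (mulgI (b (f s))); rewrite -bM !mulVKg.
by apply: (mulgI (a s)); rewrite -aM !mulVKg.
Qed.

Let ldiv_inj m x : injective (fun s => ldiv m s x).
Proof.
move=> s t; rewrite /ldiv; case: (odd m); last by move/mulIg/invg_inj.
by move/(can_inj gK)/mulIg/invg_inj/(can_inj fK).
Qed.

Let ldiv1 m x : ldiv m 1 x = x.
Proof. by rewrite /ldiv f1 !invg1 !mul1g fK if_same. Qed.

Let letter_mul m h h' : exists x, alt_letter m h * alt_letter m h' = alt_letter m x.
Proof.
exists (ldiv m (ldiv m h 1) h'); rewrite !letter_ldiv letter1 mulg1 invgK //.
Qed.

Lemma alt_wordsS m w : reflect (exists2 v, v \in alt_words m & exists h, w = v *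
  alt_letter m.+1 h)
  (w \in alt_words m.+1).
Proof.
apply: (iffP allpairsP) => [[[v h] /= [vE _ ->]]|[v vE [h ->]]].
  by exists v => //; exists h.
by exists (v, h); rewrite mem_enum.
Qed.

Lemma alt_words0 w : reflect (exists h, w = a h) (w \in alt_words 0).
Proof.
apply: (iffP mapP) => [[h _ ->]|[h ->]]; first by exists h.
by exists h; rewrite ?mem_enum.
Qed.

Lemma alt_words_absorb m v h : v \in alt_words m -> v * alt_letter m h \in alt_words m.
Proof.
case: m => [/alt_words0[x ->]|m /alt_wordsS[w wE [x ->]]].
  by apply/alt_words0; exists (x * h); rewrite aM.
apply/alt_wordsS; exists w => //; rewrite -mulgA.
by have [y ->] := letter_mul m.+1 x h; exists y.
Qed.

Lemma alt_words_sub m : {subset alt_words m <= alt_words m.+1}.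
Proof. by move=> w wE; apply/alt_wordsS; exists w => //; exists 1;
  rewrite letter1 mulg1. Qed.

(** The added letter commutes past the last letter of [u], which has the same index, and is absorbed
    by the letter before it, which is of its own kind. *)
Lemma alt_words_swap m u t : u * (alt_letter m.+1 t)^-1 \in alt_words m -> u *
  alt_letter m.+2 t \in alt_words m.+1.
Proof.
move=> ut; apply/alt_wordsS; exists (u * (alt_letter m.+1 t)^-1 * alt_letter m t).
  exact: alt_words_absorb.
by exists t; rewrite -mulgA letterC mulgA mulgKV letterSS.
Qed.

Lemma last_letters1 m u : u \notin alt_words m -> 1 \notin last_letters m u.
Proof. by rewrite inE letter1 invg1 mulg1. Qed.

(* The letters [s] of index [m.+1] and [m.+2] commute, so a last letter [s] of [v]
   gives the last letter [s^-1 x] of [v x]. *)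
Lemma last_letters_large m u : u \in alt_words m.+1 -> u \notin alt_words m ->
  (m < #|last_letters m u|)%N.
Proof.
elim: m u => [|m IHm] u /alt_wordsS[v vE [x ->]] nu.
  by rewrite (cardsD1 x) inE mulgK vE.
have nv : v \notin alt_words m.
  apply: contra nu => vm; apply: alt_words_sub; rewrite letterSS.
  exact: alt_words_absorb.
have D1 := last_letters1 nv.
pose F := (fun s => ldiv m.+2 s x) @: last_letters m v.
have xF : x \notin F.
  apply: contra D1 => /imsetP[s Ds]; rewrite -{1}(ldiv1 m.+2 x) => /ldiv_inj ->.
  exact: Ds.
apply: leq_trans (subset_leq_card (_ : x |: F \subset _)).
  by rewrite cardsU1 xF card_imset ?ltnS ?IHm //; apply: ldiv_inj.
apply/subsetP=> _ /setU1P[->|/imsetP[s Ds ->]]; rewrite inE ?mulgK //.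
rewrite letter_ldiv invMg invgK mulgA mulgK.
by apply: alt_words_swap; rewrite inE in Ds.
Qed.

(** A new word would have more than [m] last letters, but the index [1] is never among them. *)
Lemma alt_words_stop m : (#|A| <= m.+1)%N -> {subset alt_words m.+1 <= alt_words m}.
Proof.
move=> nm u uE; apply: contraT => nu; have := last_letters_large uE nu.
rewrite ltnNge; case/negP; rewrite -ltnS; apply: leq_trans nm.
apply: proper_card; apply/properP; split; first exact: subset_predT.
by exists 1; rewrite ?last_letters1.
Qed.

Hypothesis W_ind : forall S : W -> Prop, S 1 ->
  (forall w h, S w -> S (w * a h)) -> (forall w k, S w -> S (w * b k)) -> forall w, S w.

Lemma alt_words_full m w : (#|A| <= m.+1)%N -> w \in alt_words m.
Proof.
move=> nm.
have stop i : {subset alt_words (i + m) <= alt_words m}.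
  elim: i => // i IHi u /alt_words_stop H; apply: IHi; apply: H.
  by apply: leq_trans nm _; rewrite ltnS leq_addl.
have step u i : u \in alt_words i -> u \in alt_words m.
  move=> ui; apply: (stop i); elim: m {nm stop} => [|m IHm]; first by rewrite addn0.
  by rewrite addnS; apply: alt_words_sub.
elim/W_ind: w => [|w h wE|w k wE].
- by apply: (step _ 0); apply/alt_words0; exists 1.
- have [om|em] := boolP (odd m); last first.
    by have := alt_words_absorb h wE; rewrite /alt_letter (negPf em).
  apply: (step _ m.+1); apply/alt_wordsS; exists w => //; exists h.
  by rewrite /alt_letter /= om.
have [om|em] := boolP (odd m).
  by have := alt_words_absorb (g k) wE; rewrite /alt_letter om gK.
apply: (step _ m.+1); apply/alt_wordsS; exists w => //; exists (g k).
by rewrite /alt_letter /= em gK.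
Qed.

End Alternating.

Lemma card_pairs (T U : finType) (p : pred T) (q : T -> pred U) :
  #|[set tu : T * U | p tu.1 && q tu.1 tu.2]| = (\sum_(t | p t) #|[set u | q t u]|)%N.
Proof.
rewrite -sum1_card (eq_bigl (fun tu => p tu.1 && q tu.1 tu.2)) => [|[t u]];
  last by rewrite inE.
rewrite -(pair_big_dep p q (fun _ _ => 1%N)); apply: eq_bigr => t _ /=.
by rewrite -sum1_card; apply: eq_bigl => u; rewrite inE.
Qed.

(** * Counting alternating words *)

Section Count.
Variables (Q A B : finGroupType).
Variables (a : A -> Q) (b : B -> Q) (f : A -> B) (g : B -> A).
Hypotheses (aM : {morph a : x y / x * y}) (bM : {morph b : x y / x * y}).
Hypotheses (fK : cancel f g) (gK : cancel g f) (f1 : f 1 = 1).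
Hypothesis abC : forall h, commute (a h) (b (f h)).
Let E := alt_words a b f.
Local Notation letter := (alt_letter a b f).
Let D := last_letters a b f.

Definition new_words m := [set u | (u \in E m) && ~~ ((0 < m)%N && (u \in E m.-1))].

Lemma new_wordsS m u : (u \in new_words m.+1) = (u \in E m.+1) && (u \notin E m).
Proof. by rewrite inE. Qed.

(* Counts the pairs [(u, s)] such that [u] is in [E m.+1], not in [E m], and
   [u s^-1] is in [E m]. *)
Lemma card_new_words m :
  (m.+1 * #|new_words m.+1| <= (#|A| - m.+1) * #|new_words m|)%N.
Proof.
pose X := [set us : Q * A | (us.1 \in new_words m.+1) && (us.1 * (letter m.+1 us.2)^-1
  \in E m)].
pose Y := [set vs : Q * A | (vs.1 \in new_words m) && (vs.1 * letter m.+1 vs.2 \notin E m)].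
have XY : (#|X| <= #|Y|)%N.
  pose F (us : Q * A) := (us.1 * (letter m.+1 us.2)^-1, us.2).
  have FI : injective F by move=> [u s] [v t] [/= uv st]; move: uv; rewrite st => /mulIg ->.
  rewrite -(card_imset X FI); apply: subset_leq_card; apply/subsetP=> _ /imsetP[[u s] + ->].
  rewrite !inE /= -!andbA mulgKV => /and3P[uE nu us]; rewrite us nu andbT /=.
  (* If [u] without its last letter were a still shorter word, that letter would be absorbed there,
     and [u] would not be new. *)
  case: m {X Y F FI} uE nu us => //= m _ nu us; apply: contra nu => us'.
  rewrite -[u](mulgKV (letter m.+2 s)); apply: (alt_words_sub aM bM f1).
  rewrite [X in _ * X](_ : letter m.+2 s = letter m s);
    last by rewrite /alt_letter /= negbK.
  exact: (alt_words_absorb aM bM gK f1).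
have Xge : (m.+1 * #|new_words m.+1| <= #|X|)%N.
  rewrite (card_pairs (mem (new_words m.+1)) (fun u s => u * (letter m.+1 s)^-1 \in E
    m)) mulnC -sum_nat_const; apply: leq_sum => u.
  rewrite new_wordsS => /andP[uE nu].
  exact: (last_letters_large aM bM fK gK f1 abC uE nu).
(* At least [m.+1] letters keep a new word [v] inside [E m]: the identity and, by [alt_words_swap],
   the at least [m] last letters of [v]. *)
have Yle : (#|Y| <= (#|A| - m.+1) * #|new_words m|)%N.
  rewrite (card_pairs (mem (new_words m)) (fun v s => v * letter m.+1 s \notin E m))
    mulnC -sum_nat_const; apply: leq_sum => v vN.
  pose S := [set s | v * letter m.+1 s \in E m].
  have -> : [set s | v * letter m.+1 s \notin E m] = ~: S by apply/setP=> s; rewrite !inE.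
  rewrite cardsCs setCK; apply: leq_sub2l.
  move: vN; rewrite inE /new_words inE; case: m @S {X Y XY Xge} => [|m] S /andP[vE nv].
    rewrite card_gt0; apply/set0Pn; exists 1.
    by rewrite inE (letter1 aM bM f1) mulg1.
  apply: leq_trans (subset_leq_card (_ : 1 |: D m v \subset S)).
    rewrite cardsU1 (last_letters1 aM bM f1 nv) ltnS.
    exact: (last_letters_large aM bM fK gK f1 abC vE nv).
  apply/subsetP=> s /setU1P[->|].
    by rewrite inE (letter1 aM bM f1) mulg1.
  by rewrite !inE; apply: (alt_words_swap aM bM gK f1 abC).
exact: leq_trans Xge (leq_trans XY Yle).
Qed.

(** The binomial coefficients satisfy with equality the recursion of [card_new_words]. *)
Lemma new_words_bin m : (#|new_words m| <= #|A| * 'C(#|A|.-1, m))%N.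
Proof.
elim: m => [|m IHm].
  rewrite bin0 muln1; apply: leq_trans (_ : #|E 0| <= _)%N; last first.
    by rewrite (leq_trans (card_size _)) // size_map -cardE.
  by apply: subset_leq_card; apply/subsetP=> u; rewrite inE => /andP[].
rewrite -(@leq_pmul2l m.+1) //; apply: leq_trans (card_new_words m) _.
rewrite [X in (_ <= X)%N]mulnCA mul_bin_left [X in (_ <= X)%N]mulnCA; apply: leq_mul => //.
by rewrite -subn1 -subnDA add1n.
Qed.

Lemma card_alt_words m : (#|[set u in E m]| <= #|A| * \sum_(i < m.+1) 'C(#|A|.-1, i))%N.
Proof.
elim: m => [|m IHm].
  rewrite big_ord1; apply: leq_trans (new_words_bin 0).
  by apply: subset_leq_card; apply/subsetP=> u; rewrite !inE => ->.
rewrite big_ord_recr /= mulnDr; apply: leq_trans (leq_add IHm (new_words_bin m.+1)).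
apply: leq_trans (leq_card_setU _ _); apply: subset_leq_card.
by apply/subsetP=> u; rewrite in_setU new_wordsS !inE => -> /=; rewrite orbN.
Qed.

Lemma card_alternating : (forall S : Q -> Prop, S 1 ->
  (forall w h, S w -> S (w * a h)) -> (forall w k, S w -> S (w * b k)) -> forall w, S w) ->
  (#|Q| <= #|A| * 2 ^ #|A|.-1)%N.
Proof.
move=> Q_ind; have A0 : (0 < #|A|)%N by apply/card_gt0P; exists 1.
have /eq_card : [set u in E #|A|.-1] =i Q.
  move=> u; rewrite !inE; apply: (alt_words_full aM bM fK gK f1 abC Q_ind).
  by rewrite prednK.
move<-; apply: leq_trans (card_alt_words _) _; rewrite leq_mul2l.
rewrite -[2]/(1 + 1)%N expnDn prednK // leq_sum ?orbT // => i _.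
by rewrite !exp1n !muln1.
Qed.
End Count.

(** * The theorem *)

Lemma wcomm_ind (H K : groupType) (f : H -> K) (S : wcomm f -> Prop) :
    S 1 -> (forall w h, S w -> S (w * wcomm_inl f h)) ->
    (forall w k, S w -> S (w * wcomm_inr f k)) -> forall w, S w.
Proof.
move=> S1 Sl Sr w; have [z ->] := ncl_pi_surj w; have [u ->] := fp_word_surj z.
elim/last_ind: u => [|u s IHu]; first exact: S1.
have -> : fp_word (rcons u s) = fp_word u * fp_word [:: s].
  by rewrite -cats1 [RHS]fp_mulE.
by rewrite ncl_piM; case: s => x; [apply: Sl | apply: Sr].
Qed.

Lemma finite_isomorphic (W : groupType) (s : seq W) : (forall w, w \in s) ->
  exists Q : finGroupType, isomorphic W Q.
Proof.
move=> sW; pose T := seq_sub s; pose i (w : W) : T := SeqSub (sW w).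
have iK (t : T) : i (val t) = t by apply: val_inj.
pose mul (x y : T) := i (val x * val y).
have mulA : associative mul by move=> x y z; apply: val_inj; rewrite /= mulgA.
have mul1 : left_id (i 1) mul by move=> x; apply: val_inj; rewrite /= mul1g.
have mulV : left_inverse (i 1) (fun x => i (val x)^-1) mul.
  by move=> x; apply: val_inj; rewrite /= mulVg.
pose Qm := Finite_isGroup.Build T mulA mul1 mulV.
pose Q : finGroupType := HB.pack T Qm.
have iM : {morph (i : W -> Q) : x y / x * y} by move=> x y; apply: val_inj.
pose phim := isMultiplicative.Build _ _ (i : W -> Q) iM.
pose phi : {multiplicative W -> Q} := HB.pack (i : W -> Q) phim.
by exists Q, phi; exists val => // x; apply: val_inj.
Qed.

Section Model.
Variables (A B : finGroupType) (f : A -> B) (g : B -> A).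
Hypotheses (fK : cancel f g) (gK : cancel g f) (f1 : f 1 = 1).

Lemma wcomm_finite_model : exists (Q : finGroupType)
    (a : {morphism [set: A] >-> Q}) (b : {morphism [set: B] >-> Q}),
  [/\ isomorphic (wcomm f) Q, forall h, commute (a h) (b (f h)), jointly_gen a b
    & (#|Q| <= #|A| * 2 ^ #|A|.-1)%N].
Proof.
have [Q isoQ] : exists Q : finGroupType, isomorphic (wcomm f) Q.
  apply: (@finite_isomorphic _ (alt_words (wcomm_inl f) (wcomm_inr f) f #|A|)) => w.
  apply: (alt_words_full (wcomm_inlM f) (wcomm_inrM f) fK gK f1) => //.
    exact: wcomm_commute.
  exact: wcomm_ind.
have [phi [psi phiK psiK]] := isoQ.
have aM : {in [set: A] &, {morph (fun h => phi (wcomm_inl f h)) : x y / x * y}}.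
  by move=> x y _ _; rewrite wcomm_inlM gmulfM.
have bM : {in [set: B] &, {morph (fun k => phi (wcomm_inr f k)) : x y / x * y}}.
  by move=> x y _ _; rewrite wcomm_inrM gmulfM.
have Q_ind (S : Q -> Prop) : S 1 -> (forall w h, S w -> S (w * phi (wcomm_inl f h))) ->
    (forall w k, S w -> S (w * phi (wcomm_inr f k))) -> forall w, S w.
  move=> S1 Sl Sr w; rewrite -(psiK w); elim/wcomm_ind: (psi w) => [|v h Sv|v k Sv].
  - by have -> : phi 1 = 1 by apply: (mulgI (phi 1)); rewrite -gmulfM !mulg1.
  - by rewrite gmulfM; apply: Sl.
  - by rewrite gmulfM; apply: Sr.
have abC h : commute (phi (wcomm_inl f h)) (phi (wcomm_inr f (f h))).
  by rewrite /commute -!gmulfM wcomm_commute.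
exists Q, (Morphism aM), (Morphism bM); split=> //.
- move=> S aS bS; apply/setP=> w; rewrite in_setT.
  by elim/Q_ind: w => [|w h Sw|w k Sw]; rewrite ?group1 ?groupM ?aS ?bS.
- apply: (card_alternating _ _ fK gK f1 abC Q_ind) => x y.
    by rewrite wcomm_inlM gmulfM.
  by rewrite wcomm_inrM gmulfM.
Qed.

End Model.

(** In a nilpotent group the [p]-core contains every [p]-element, in particular all generators. *)
Lemma pgroup_of_gen (p : nat) (Q A B : finGroupType)
    (a : {morphism [set: A] >-> Q}) (b : {morphism [set: B] >-> Q}) :
    p.-group [set: A] -> p.-group [set: B] -> jointly_gen a b ->
  nilpotent [set: Q] -> p.-group [set: Q].
Proof.
move=> pA pB ab nQ; have hallO := nilpotent_pcore_Hall p nQ.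
have inO x : p.-elt x -> x \in 'O_p([set: Q]).
  by move=> px; rewrite (mem_normal_Hall hallO (pcore_normal _ _)) ?in_setT.
rewrite -(ab 'O_p([set: Q])%G) ?pcore_pgroup // => x; apply: inO.
  exact: morph_p_elt (in_setT x) (mem_p_elt pA (in_setT x)).
exact: morph_p_elt (in_setT x) (mem_p_elt pB (in_setT x)).
Qed.

Lemma rank_abelem_card (p k : nat) (A : finGroupType) :
  p.-abelem [set: A] -> 'r([set: A]) = k -> #|A| = (p ^ k)%N.
Proof.
by move=> abA rA; rewrite -cardsT (card_pgroup (abelem_pgroup abA)) -rank_abelem ?rA.
Qed.

Lemma abelem_expg (p : nat) (A : finGroupType) (x : A) : p.-abelem [set: A] -> x ^+ p = 1.
Proof. by case/and3P=> _ _ /exponentP; apply; apply: in_setT. Qed.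

Theorem theorem4 :
  (forall (k : nat) (A B : finGroupType) (f : A -> B),
      k = 3 \/ k = 4 ->
      2.-abelem [set: A] -> 'r([set: A]) = k ->
      [set: A] \isog [set: B] ->
      bijective f -> f 1 = 1 ->
      exists Q : finGroupType,
        isomorphic (wcomm f) Q /\
        [/\ 2.-group [set: Q],
            (#|Q| <= 2 ^ (2 ^ k + k - 1))%N,
            nilpotent [set: Q],
            (nil_class [set: Q] <= 5)%N
          & [set: Q]^`(3) = 1])
  /\
  (forall (A B : finGroupType) (f : A -> B),
      3.-abelem [set: A] -> 'r([set: A]) = 3 ->
      [set: A] \isog [set: B] ->
      bijective f -> f 1 = 1 ->
      exists Q : finGroupType,
        isomorphic (wcomm f) Q /\
        [/\ 3.-group [set: Q],
            (#|Q| <= 3 ^ 9)%N,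
            nilpotent [set: Q]
          & (nil_class [set: Q] <= 2)%N]).
Proof.
split=> [k A B f k34|A B f] abA rA isoAB [g fK gK] f1.
  have abB : 2.-abelem [set: B] by rewrite -(isog_abelem isoAB).
  have oA := rank_abelem_card abA rA.
  have [Q [a [b [isoQ abC ab oQ]]]] := wcomm_finite_model fK gK f1.
  have [nilQ clQ derQ] : [/\ nilpotent [set: Q], (nil_class [set: Q] <= 5)%N & [set:
    Q]^`(3) = 1].
    apply: (class5_two_groups_le _ _ _ fK gK f1 abC ab) => [x|x|].
    - by rewrite -(abelem_expg x abA) expgS expg1.
    - by rewrite -(abelem_expg x abB) expgS expg1.
    - by rewrite oA; case: k34 => ->; auto.
  exists Q; split=> //; split=> //.
    exact: pgroup_of_gen (abelem_pgroup abA) (abelem_pgroup abB) ab nilQ.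
  apply: leq_trans oQ _; rewrite oA -expnD leq_exp2l //.
  by case: k34 => ->.
have abB : 3.-abelem [set: B] by rewrite -(isog_abelem isoAB).
have oA : #|A| = 27 := rank_abelem_card abA rA.
have [Q [a [b [isoQ abC ab _]]]] := wcomm_finite_model fK gK f1.
have [nilQ clQ oQ] := class2_three_groups (abelem_abelian abA) (abelem_abelian abB)
  (fun x => abelem_expg x abA) (fun x => abelem_expg x abB) oA fK gK f1 abC ab.
exists Q; split=> //; split=> //.
exact: pgroup_of_gen (abelem_pgroup abA) (abelem_pgroup abB) ab nilQ.
Qed.
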